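(* Let $B$ be a complex Banach space and $H\subseteq B$ a complex Hilbert space. Assume that there exists a bounded real structure on $B$ such that its restriction to $H$ is an isometric real structure on $H$. Suppose that $Z$ is a $B$-valued random field and write $$X:=\sqrt2\,\operatorname{Re}Z,\qquad Y:=\sqrt2\,\operatorname{Im}Z.$$ Then the following are equivalent. (i) $Z$ is distributed by $\nu$ with $(H,B,\nu)$ a complex abstract Wiener space. (ii) $X$ and $Y$ are independent and identically distributed by $\nu_{\mathbb R}$ with $(H_{\mathbb R},B_{\mathbb R},\nu_{\mathbb R})$ a real abstract Wiener space.
   Context: A real structure on a complex vector space $B$ is an anti-linear involution $\sigma:B\to B$. Its real part is $B_{\mathbb R}=\{x\in B:\sigma(x)=x\}$, and $\operatorname{Re}x=\frac{x+\sigma(x)}2$, $\operatorname{Im}x=\frac{x-\sigma(x)}{2i}$ are the associated projections $B\to B_{\mathbb R}$. The real structure is bounded if $\sigma$ is bounded for the $B$-norm; it is isometric on $H$ if $\|\sigma(x)\|_H=\|x\|_H$ for all $x\in H$. $B_{\mathbb R}$ carries the $B$-norm, and $H_{\mathbb R}=H\cap B_{\mathbb R}$ carries the $H$-norm (it is then a real Hilbert space with the restricted inner product). A $B$-valued random field is a Borel measurable map from a probability space to $B$. Let $\mathbb K\in\{\mathbb R,\mathbb C\}$ and $\kappa=\dim_{\mathbb R}\mathbb K\in\{1,2\}$. ''$H\subseteq B$ algebraically, densely and topologically'' means $H$ is a linear subspace of $B$, dense in $B$, and the $H$-norm is stronger than the $B$-norm. A triple $(H,B,\nu)$ is an abstract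 Wiener space over $\mathbb K$ (real if $\mathbb K=\mathbb R$, complex if $\mathbb K=\mathbb C$) if $H$ is a separable Hilbert space over $\mathbb K$, $B$ is a separable Banach space over $\mathbb K$, $H\subseteq B$ algebraically, densely and topologically, and $\nu$ is a probability measure on the Borel $\sigma$-algebra of $B$ with characteristic function $\phi_\nu(f)=\int_B\exp(i\operatorname{Re}f(x))\,d\nu(x)=\exp\big(-\tfrac1{2\kappa}\|f\|_{H'}^2\big)$ for all $f\in B'$, where $B'$, $H'$ are topological duals and $\|f\|_{H'}$ is the operator norm of $f|_H$. *)

(* Defs.v *)
From HB Require Import structures.
From mathcomp Require Import all_boot all_order all_algebra.
From mathcomp Require Import complex.
From mathcomp Require Import all_classical all_reals all_analysis.

Set Implicit Arguments.
Unset Strict Implicit.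
Unset Printing Implicit Defensive.

Import Order.TTheory GRing.Theory Num.Theory.
Import numFieldNormedType.Exports.

Local Open Scope classical_set_scope.
Local Open Scope ring_scope.
Local Open Scope complex_scope.

Definition borel (T : ptopologicalType) := g_sigma_algebraType (@open T).

Definition separable (T : topologicalType) : Prop :=
  exists2 D : set T, countable D & dense D.

(* A candidate Hilbert space sitting inside B.  The values of [ips_dot] outside
   [ips_set] are irrelevant. *)
Record inner_product_subspace (K : numFieldType) (B : lmodType K) := {
  ips_set :> set B;
  ips_dot : B -> B -> K
}.

(* The notions for K = R and K = C share one definition, parameterized by the
   real part and the conjugation of K; they are only meant for
   (K, re, conj) = (R, id, id) and (R[i], Re, conjc). *)
Section HilbertSubspace.
Context (R : realType) (K : numFieldType) (re : K -> R) (conj : K -> K).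
Context (B : lmodType K).
Implicit Type H : inner_product_subspace B.

Definition hnorm H (x : B) : R := Num.sqrt (re (ips_dot H x x)).

Definition is_linear_subspace (A : set B) : Prop :=
  A 0 /\ forall (a : K) (x y : B), A x -> A y -> A (a *: x + y).

Definition is_inner_product H : Prop :=
  [/\ forall (a : K) (x y z : B),
        ips_set H x -> ips_set H y -> ips_set H z ->
        ips_dot H (a *: x + y) z = a * ips_dot H x z + ips_dot H y z,
      forall x y : B, ips_set H x -> ips_set H y ->
        ips_dot H y x = conj (ips_dot H x y),
      forall x : B, ips_set H x -> 0 <= ips_dot H x x
    & forall x : B, ips_set H x -> ips_dot H x x = 0 -> x = 0].

Definition hcomplete H : Prop :=
  forall u : nat -> B, (forall n, ips_set H (u n)) ->
    (forall e : R, 0 < e -> exists N : nat, forall m n : nat,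
        (N <= m)%N -> (N <= n)%N -> hnorm H (u m - u n) < e) ->
    exists2 l : B, ips_set H l &
      forall e : R, 0 < e -> exists N : nat, forall n : nat,
        (N <= n)%N -> hnorm H (u n - l) < e.

Definition is_hilbert_subspace H : Prop :=
  [/\ is_linear_subspace H, is_inner_product H & hcomplete H].

Definition hseparable H : Prop :=
  exists D : set B, [/\ countable D, D `<=` H &
    forall x : B, ips_set H x -> forall e : R, 0 < e ->
      exists2 y : B, D y & hnorm H (x - y) < e].

(* Operator norm of f restricted to H.  [sup] is 0 on unbounded sets, which does
   not occur for f continuous on B and the H-norm stronger than the B-norm. *)
Definition dual_norm H (f : B -> K) : R :=
  sup [set re `|f x| | x in [set x : B | ips_set H x /\ hnorm H x <= 1]].

End HilbertSubspace.

Section AbstractWienerSpace.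
Context (R : realType).

Definition expi (t : R) : R[i] := cos t +i* sin t.

Definition complex_integral d (T : measurableType d)
    (mu : {measure set T -> \bar R}) (g : T -> R[i]) : R[i] :=
  (\int[mu]_x complex.Re (g x)) +i* (\int[mu]_x complex.Im (g x)).

Section ScalarField.
Context (K : numFieldType) (re : K -> R) (conj : K -> K) (kappa : nat).

Definition char_fun (B : completeNormedModType K)
    (nu : probability (borel B) R) (f : B -> K) : R[i] :=
  complex_integral nu (fun x => expi (re (f x))).

Definition is_abstract_wiener_space (B : completeNormedModType K)
    (H : inner_product_subspace B) (nu : probability (borel B) R) : Prop :=
  [/\ is_hilbert_subspace re conj H /\ hseparable re H,
      separable B,
      dense (H : set B),
      exists C : R, forall x : B, ips_set H x -> re `|x| <= C * hnorm re H x
    & forall f : {scalar B}, continuous f ->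
        char_fun nu f =
        (expR (- (1 / (2 * kappa%:R)) * dual_norm re H f ^+ 2))%:C].

End ScalarField.

Definition real_abstract_wiener_space (B : completeNormedModType R)
    (H : inner_product_subspace B) (nu : probability (borel B) R) : Prop :=
  @is_abstract_wiener_space R id id 1 B H nu.

Definition complex_abstract_wiener_space (B : completeNormedModType R[i])
    (H : inner_product_subspace B) (nu : probability (borel B) R) : Prop :=
  @is_abstract_wiener_space R[i] (@complex.Re R) (@conjc R) 2 B H nu.

End AbstractWienerSpace.

(* Semilinearity for the scaling law [conjc \; *:%R] is antilinearity. *)
Record real_structure (R : realType) (B : completeNormedModType R[i]) := {
  rs_map :> {linear B -> B | (@conjc R : R[i] -> R[i]) \; *:%R};
  rs_involutive : involutive rs_map
}.

Record bounded_real_structure (R : realType)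
    (B : completeNormedModType R[i]) := {
  brs_map :> real_structure B;
  brs_bounded : exists C : R, forall x : B, `|brs_map x| <= C%:C * `|x|
}.

Definition isometric_real_structure_on (R : realType)
    (B : completeNormedModType R[i]) (sigma : real_structure B)
    (H : inner_product_subspace B) : Prop :=
  forall x : B, ips_set H x ->
    ips_set H (sigma x) /\
    hnorm (@complex.Re R) H (sigma x) = hnorm (@complex.Re R) H x.

(* B_R.  Boundedness of sigma makes it closed in B, hence a Banach space. *)
Record real_part (R : realType) (B : completeNormedModType R[i])
    (sigma : bounded_real_structure B) := RealPart {
  rval : B;
  rvalP : sigma rval == rval
}.

Section RealPart.
Context (R : realType) (B : completeNormedModType R[i]).
Context (sigma : bounded_real_structure B).
Local Notation BR := (real_part sigma).

HB.instance Definition _ := [isSub for @rval R B sigma].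
HB.instance Definition _ := [Choice of BR by <:].

Lemma rval_inj : injective (@rval R B sigma).
Proof. exact: val_inj. Qed.

Lemma rvalE (x : BR) : sigma (rval x) = rval x.
Proof. exact/eqP/rvalP. Qed.

Lemma sigmaZ (a : R[i]) (x : B) : sigma (a *: x) = conjc a *: sigma x.
Proof. exact: linearZ. Qed.

Fact real_part0 : sigma 0 == 0. Proof. by rewrite linear0. Qed.
Fact real_partN (x : BR) : sigma (- rval x) == - rval x.
Proof. by rewrite linearN rvalE. Qed.
Fact real_partD (x y : BR) : sigma (rval x + rval y) == rval x + rval y.
Proof. by rewrite linearD !rvalE. Qed.
Fact real_partZ (a : R) (x : BR) : sigma (a%:C *: rval x) == a%:C *: rval x.
Proof. by rewrite sigmaZ conjc_real rvalE. Qed.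

Definition rp0 : BR := RealPart real_part0.
Definition rpN (x : BR) : BR := RealPart (real_partN x).
Definition rpD (x y : BR) : BR := RealPart (real_partD x y).
Definition rpZ (a : R) (x : BR) : BR := RealPart (real_partZ a x).

Fact rpDA : associative rpD.
Proof. by move=> x y z; apply: rval_inj; rewrite /= addrA. Qed.
Fact rpDC : commutative rpD.
Proof. by move=> x y; apply: rval_inj; rewrite /= addrC. Qed.
Fact rp0D : left_id rp0 rpD.
Proof. by move=> x; apply: rval_inj; rewrite /= add0r. Qed.
Fact rpND : left_inverse rp0 rpN rpD.
Proof. by move=> x; apply: rval_inj; rewrite /= addNr. Qed.
HB.instance Definition _ := GRing.isZmodule.Build BR rpDA rpDC rp0D rpND.

Fact rpZA (a b : R) (v : BR) : rpZ a (rpZ b v) = rpZ (a * b) v.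
Proof. by apply: rval_inj; rewrite /= scalerA rmorphM. Qed.
Fact rpZ1 : left_id 1 rpZ.
Proof. by move=> x; apply: rval_inj; rewrite /= scale1r. Qed.
Fact rpZDr : right_distributive rpZ +%R.
Proof. by move=> a x y; apply: rval_inj; rewrite /= scalerDr. Qed.
Fact rpZDl (v : BR) : {morph rpZ^~ v : a b / a + b}.
Proof. by move=> a b; apply: rval_inj; rewrite /= rmorphD scalerDl. Qed.
HB.instance Definition _ :=
  GRing.Zmodule_isLmodule.Build R BR rpZA rpZ1 rpZDr rpZDl.

Definition rpnorm (x : BR) : R := complex.Re `|rval x|.

Lemma rpnormE (x : BR) : (rpnorm x)%:C = `|rval x|.
Proof. by rewrite /rpnorm RRe_real// ger0_real. Qed.

Fact rpnormD (x y : BR) : rpnorm (x + y) <= rpnorm x + rpnorm y.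
Proof. by rewrite -lecR rmorphD /= !rpnormE ler_normD. Qed.
Fact rpnormZ (a : R) (x : BR) : rpnorm (a *: x) = `|a| * rpnorm x.
Proof.
apply: (@complexI R); rewrite rmorphM /= !rpnormE normrZ; congr (_ * _).
by rewrite normc_def /= expr0n /= addr0 sqrtr_sqr.
Qed.
Fact rpnorm0_eq0 (x : BR) : rpnorm x = 0 -> x = 0.
Proof.
by move=> x0; apply/rval_inj/eqP; rewrite -normr_eq0 -rpnormE x0.
Qed.
HB.instance Definition _ :=
  Lmodule_isNormed.Build R BR rpnormD rpnormZ rpnorm0_eq0.

End RealPart.

Section RealPartComplete.
Context (R : realType) (B : completeNormedModType R[i]).
Context (sigma : bounded_real_structure B).
Local Notation BR := (real_part sigma).

Lemma rval_norm (x : BR) : `|rval x| = `|x|%:C.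
Proof. by rewrite -rpnormE. Qed.

Lemma sigma_closed (F : set_system B) (l : B) : ProperFilter F ->
  F [set x | sigma x = x] -> F --> l -> sigma l = l.
Proof.
move=> FF Fs /cvgrPdist_lt Fl; apply/eqP; rewrite -subr_eq0 -normr_le0.
have [C sC] := brs_bounded sigma.
have C0 : 0 < (`|C| + 1)%:C :> R[i] by rewrite ltcR ltr_wpDl.
apply/ler_addgt0Pr => e e0; rewrite add0r.
have d0 : 0 < e / (`|C| + 1)%:C by rewrite divr_gt0.
have [x [sx lx]] := filter_ex (filterI Fs (Fl _ d0)).
rewrite -[_ - l](subrKA x) -[in X in `|X + _|]sx -linearB.
rewrite (le_trans (ler_normD _ _))// (distrC x).
rewrite (le_trans (lerD (sC _) (lexx _)))//.
rewrite -{2}[`|l - x|]mul1r -mulrDl.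
apply: (@le_trans _ _ ((`|C| + 1)%:C * `|l - x|)).
  by rewrite ler_wpM2r// rmorphD /= lerD2r lecR ler_norm.
by rewrite mulrC -ler_pdivlMr// ltW.
Qed.

Lemma real_part_cvg (F : set_system BR) : ProperFilter F -> cauchy F -> cvg F.
Proof.
move=> FF /cauchy_ballP Fc.
have FvF : ProperFilter (@rval R B sigma @ F) by exact: fmap_proper_filter.
have : cauchy (@rval R B sigma @ F).
  apply/cauchy_ballP => e e0.
  have eE : (complex.Re e)%:C = e by rewrite RRe_real// gtr0_real.
  have re0 : 0 < complex.Re e by rewrite -ltcR eE.
  have [[P Q] /= [FP FQ] PQ] := Fc _ re0.
  exists (@rval R B sigma @` P, @rval R B sigma @` Q) => /=.
    by split; [apply: filterS FP|apply: filterS FQ] => x Px; exists x.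
  move=> [x y] /= [[p Pp <-] [q Qq <-]].
  have := PQ (p, q) (conj Pp Qq); rewrite -!ball_normE /ball_ /=.
  by rewrite -[rval p - rval q]/(rval (p - q)) rval_norm -eE ltcR.
move=> /cauchy_cvg /cvg_ex [l /= Fl].
have sl : sigma l = l.
  apply: sigma_closed Fl.
  by rewrite /fmap /=; apply: (@filterS _ F _ setT); [|exact: filterT] => x _;
    exact: (rvalE x).
have /eqP sl' := sl.
apply/cvg_ex; exists (RealPart sl').
apply/cvgrPdist_lt => e e0.
move/cvgrPdist_lt : Fl => /(_ e%:C).
rewrite ltcR => /(_ e0); apply: filterS => x /=.
by rewrite -[l - rval x]/(rval (RealPart sl' - x)) rval_norm ltcR.
Qed.

HB.instance Definition _ := Uniform_isComplete.Build BR real_part_cvg.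

End RealPartComplete.

Section RealProjections.
Context (R : realType) (B : completeNormedModType R[i]).
Context (sigma : bounded_real_structure B).

Fact re_part_subproof (x : B) :
  sigma (2^-1 *: (x + sigma x)) == 2^-1 *: (x + sigma x).
Proof.
by rewrite sigmaZ linearD rs_involutive conjc_inv (rmorph_nat (@conjc R)) addrC.
Qed.

Definition re_part (x : B) : real_part sigma := RealPart (re_part_subproof x).

Fact im_part_subproof (x : B) :
  sigma ((2 * 'i%C)^-1 *: (x - sigma x)) == (2 * 'i%C)^-1 *: (x - sigma x).
Proof.
have conj2i : conjc (2 * 'i%C) = - (2 * 'i%C) :> R[i].
  rewrite -mulrN (rmorphM (@conjc R)) (rmorph_nat (@conjc R)) /=.
  by congr (_ * _); apply/eqP; rewrite eq_complex /= oppr0 !eqxx.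
rewrite sigmaZ linearB rs_involutive conjc_inv conj2i.
by rewrite invrN scaleNr -scalerN opprB.
Qed.

Definition im_part (x : B) : real_part sigma := RealPart (im_part_subproof x).

(* H_R.  The inner product of H is real-valued on H_R when sigma is isometric
   on H; taking its real part only serves the typing. *)
Definition real_subspace (H : inner_product_subspace B) :
    inner_product_subspace (real_part sigma) :=
  {| ips_set := [set x : real_part sigma | ips_set H (rval x)];
     ips_dot := fun x y => complex.Re (ips_dot H (rval x) (rval y)) |}.

End RealProjections.

Section RandomFields.
Context (R : realType) (d d' : measure_display).
Context (T : measurableType d) (T' : measurableType d').
Context (P : probability T R).

Definition distributed_by (X : T -> T') (nu : probability T' R) : Prop :=
  measurable_fun setT X /\
  forall A : set T', measurable A -> pushforward P X A = nu A.

Definition independent (X Y : T -> T') : Prop :=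
  forall A C : set T', measurable A -> measurable C ->
    P ((X @^-1` A) `&` (Y @^-1` C)) = (P (X @^-1` A) * P (Y @^-1` C))%E.

End RandomFields.

(* Main.v *)
Require Import Defs.
From HB Require Import structures.
From mathcomp Require Import all_boot all_order all_algebra.
From mathcomp Require Import complex.
From mathcomp Require Import all_classical all_reals all_analysis.
From mathcomp Require Import measurable_realfun ring lra.

Set Implicit Arguments.
Unset Strict Implicit.
Unset Printing Implicit Defensive.

Import Order.TTheory GRing.Theory Num.Theory.
Import numFieldNormedType.Exports.

Local Open Scope classical_set_scope.
Local Open Scope ring_scope.
Local Open Scope complex_scope.

(** Characteristic functions carry the whole equivalence.  A continuous complex
    functional [L] on [B] is encoded by its real traces [f x = Re (L x)] and
    [g y = Re (L (i y))] on the real part of [B], and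
    [Re (L z) = f (Re z) + g (Im z)].  So [sqrt 2 * Re (L Z) = f X + g Y], and
    knowing the characteristic function of [Z] is the same as knowing the joint
    characteristic function of the pair [(X, Y)].

    Since [sigma] is isometric on [H] and maps [x + i y] to [x - i y], the
    parallelogram identity gives [|x + i y|^2 = |x|^2 + |y|^2] for [x], [y] in
    the real part of [H] ([sqr_hnorm_recomp]).  Dually the squared norm of [L]
    is the sum of the squared norms of its traces ([sqr_dual_norm_split]), so
    the exponential prescribed for [Z] at [L] splits as a product of one factor
    in [f] and one in [g].  From right to left, independence of [X] and [Y]
    multiplies the two real Gaussian factors into the complex one.  From left to
    right, the joint characteristic function of [(X, Y)] factors, and the
    conclusion follows once characteristic functions are known to determine laws
    ([eq_law_of_char]) and to detect independence ([independent_of_char]) on a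
    separable Banach space.

    That last point is an approximation argument.  Let [trig_closed] be
    the smallest linear space of functions that contains [cos f] and [sin f] for
    every continuous linear [f] and is closed under bounded pointwise limits of
    sequences.  It is an algebra, by the product formulas; being closed under
    limits of polynomials, it contains the indicators of half-spaces; and by the
    Hahn-Banach theorem ([norming_functional]) closed balls are countable
    intersections of half-spaces, so that it contains the indicators of all
    Borel sets ([trig_closed_borel]).  An identity between integrals that is
    linear in the integrand and stable under dominated convergence therefore
    passes from characters to Borel sets ([trig_closed_integral_eq]).

    The remaining properties of an abstract Wiener space (completeness,
    separability, density, comparison of norms) pass between [(H, B)] and its
    real part because [z |-> (Re z, Im z)] is a bounded bijection on [B], with
    bounded inverse, and an isometry on [H]. *)

(** * Hahn-Banach by minimal sublinear functionals *)

Definition sublinear (R : realType) (E : lmodType R) (q : E -> R) : Prop :=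
  (forall x y, q (x + y) <= q x + q y) /\
  (forall (a : R) x, 0 < a -> q (a *: x) = a * q x).

Section Sublinear.
Context (R : realType) (E : lmodType R).
Implicit Types (p q : E -> R) (a x y : E).

Lemma sublinear0 q : sublinear q -> q 0 = 0.
Proof.
move=> [_ qZ]; have := qZ 2 0 (ltr0Sn R 1); rewrite scaler0; lra.
Qed.

Lemma sublinearN q x : sublinear q -> - q (- x) <= q x.
Proof.
move=> sq; have := sublinear0 sq; have := sq.1 x (- x).
by rewrite subrr => h q0; move: h; rewrite q0; lra.
Qed.

Let chord_set q a x : set R := [set q (x + t *: a) - t * q a | t in [set t | 0 <= t]].

(** [q] pushed down along the direction [a] as far as sublinearity permits: the
    value at [- a] drops to [- q a] ([lower_chord_opp]). *)
Definition lower_chord q a x : R := inf (chord_set q a x).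

Let chord_has_inf q a x : sublinear q -> has_inf (chord_set q a x).
Proof.
move=> sq; split; first by exists (q (x + 0 *: a) - 0 * q a), 0 => /=.
exists (- q (- x)) => _ [t /= t0 <-].
have -> : t * q a = q (t *: a).
  move: t0; rewrite le_eqVlt => /predU1P[<-|t0]; last by rewrite sq.2.
  by rewrite mul0r scale0r sublinear0.
have := sq.1 (x + t *: a) (- x); rewrite addrAC subrr add0r; lra.
Qed.

Lemma lower_chord_le q a x t : sublinear q -> 0 <= t ->
  lower_chord q a x <= q (x + t *: a) - t * q a.
Proof.
by move=> sq t0; apply: ge_inf; [exact: (chord_has_inf _ _ sq).2|exists t].
Qed.

Lemma lower_chord_ge q a x (m : R) :
  (forall t, 0 <= t -> m <= q (x + t *: a) - t * q a) -> m <= lower_chord q a x.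
Proof.
move=> h; apply: lb_le_inf; last by move=> _ [t /= t0 <-]; exact: h.
by exists (q (x + 0 *: a) - 0 * q a), 0 => /=.
Qed.

Lemma sublinear_lower_chord q a : sublinear q -> sublinear (lower_chord q a).
Proof.
move=> sq; split=> [x y|c x c0].
  apply/ler_addgt0Pr => e e0.
  have e2 : 0 < e / 2 by rewrite divr_gt0.
  have [_ [s /= s0 <-] hs] := inf_adherent e2 (chord_has_inf a x sq).
  have [_ [t /= t0 <-] ht] := inf_adherent e2 (chord_has_inf a y sq).
  apply: (le_trans (lower_chord_le a (x + y) sq (addr_ge0 s0 t0))).
  have := sq.1 (x + s *: a) (y + t *: a).
  rewrite addrACA -scalerDl => h.
  move: hs ht; rewrite -!/(lower_chord _ _ _); lra.
have key (c' : R) (x' : E) : 0 < c' ->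
    lower_chord q a (c' *: x') <= c' * lower_chord q a x'.
  move=> c'0; rewrite mulrC -ler_pdivrMr//; apply: lower_chord_ge => t t0.
  rewrite ler_pdivrMr//.
  have := lower_chord_le a (c' *: x') sq (mulr_ge0 (ltW c'0) t0).
  rewrite -scalerA -scalerDr sq.2//; lra.
apply/eqP; rewrite eq_le key//=.
have := key c^-1 (c *: x); rewrite invr_gt0 scalerA mulVf ?gt_eqF// scale1r.
by move=> /(_ c0); rewrite mulrC ler_pdivlMr// mulrC.
Qed.

Lemma lower_chord_opp q a : sublinear q -> lower_chord q a (- a) <= - q a.
Proof.
move=> sq; have := lower_chord_le a (- a) sq ler01.
by rewrite scale1r addNr (sublinear0 sq) mul1r add0r.
Qed.

Lemma lower_chord_le_id q a x : sublinear q -> lower_chord q a x <= q x.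
Proof.
move=> sq; have := lower_chord_le a x sq (lexx 0).
by rewrite scale0r addr0 mul0r subr0.
Qed.

(** Zorn's lemma for the reversed pointwise order.  The infimum of a chain is
    finite because every sublinear [q <= p] satisfies
    [- p (- x) <= - q (- x) <= q x]. *)
Lemma minimal_sublinear p : sublinear p ->
  exists q, [/\ sublinear q, forall x, q x <= p x &
    forall r, sublinear r -> (forall x, r x <= q x) -> r = q].
Proof.
move=> sp.
pose T := {q : E -> R | sublinear q /\ forall x, q x <= p x}.
pose le (q r : T) := `[< forall x, sval r x <= sval q x >].
have [| | | |q qmin] := @Zorn T le.
- by move=> q; apply/asboolP.
- move=> q r s /asboolP qr /asboolP rs; apply/asboolP => x.
  exact: le_trans (rs x) (qr x).
- move=> [q sq] [r sr] /asboolP /= qr /asboolP /= rq; apply: eq_exist.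
  by apply/funext => x; apply/eqP; rewrite eq_le qr rq.
- move=> A Atot.
  have [[q0 Aq0]|A0] := pselect (A !=set0); last first.
    exists (exist _ p (conj sp (fun=> lexx _))) => s As.
    by exfalso; apply: A0; exists s.
  pose V x : set R := [set sval q x | q in A].
  have Vinf x : has_inf (V x).
    split; first by exists (sval q0 x), q0.
    exists (- p (- x)) => _ [q Aq <-].
    apply: le_trans (sublinearN x (svalP q).1).
    by rewrite lerN2 (svalP q).2.
  have Vle x (q : T) : A q -> inf (V x) <= sval q x.
    by move=> Aq; apply: ge_inf; [exact: (Vinf x).2|exists q].
  have Vsub : sublinear (fun x => inf (V x)).
    split=> [x y|c x c0].
      apply/ler_addgt0Pr => e e0.
      have e2 : 0 < e / 2 by rewrite divr_gt0.
      have [_ [q Aq <-] hq] := inf_adherent e2 (Vinf x).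
      have [_ [r Ar <-] hr] := inf_adherent e2 (Vinf y).
      have [/asboolP qr|/asboolP rq] := Atot _ _ Aq Ar.
        have := Vle (x + y) _ Ar; have := (svalP r).1.1 x y; have := qr x.
        by move=> /=; lra.
      have := Vle (x + y) _ Aq; have := (svalP q).1.1 x y; have := rq y.
      by move=> /=; lra.
    apply/eqP; rewrite eq_le; apply/andP; split.
      rewrite mulrC -ler_pdivrMr//; apply: lb_le_inf (Vinf x).1 _.
      by move=> _ [q Aq <-]; rewrite ler_pdivrMr// mulrC -(svalP q).1.2// Vle.
    apply: lb_le_inf (Vinf (c *: x)).1 _ => _ [q Aq <-].
    by rewrite (svalP q).1.2// ler_wpM2l ?(ltW c0)// Vle.
  have Vp x : inf (V x) <= p x.
    exact: le_trans (Vle x _ Aq0) ((svalP q0).2 x).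
  exists (exist _ (fun x => inf (V x)) (conj Vsub Vp)) => s As.
  by apply/asboolP => x /=; exact: Vle.
exists (sval q); split; [exact: (svalP q).1|exact: (svalP q).2|].
move=> r sr rq.
have rp x : r x <= p x by exact: le_trans (rq x) ((svalP q).2 x).
by have := qmin (exist _ r (conj sr rp)) (asboolT rq) => <-.
Qed.

(** Pushing a minimal [q] down along [x] cannot change it, yet gives the value
    [- q x] at [- x]. *)
Lemma minimal_sublinear_odd q x : sublinear q ->
  (forall r, sublinear r -> (forall y, r y <= q y) -> r = q) ->
  q (- x) = - q x.
Proof.
move=> sq qmin.
have qx := qmin _ (sublinear_lower_chord x sq)
  (fun y => lower_chord_le_id x y sq).
apply/eqP; rewrite eq_le -{1}qx lower_chord_opp//=.
by rewrite lerNl sublinearN.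
Qed.

(** The Hahn-Banach theorem: a minimal sublinear functional is odd, and an odd
    sublinear functional is linear. *)
Lemma linear_le_sublinear p :
  sublinear p -> exists f : {scalar E}, forall x, f x <= p x.
Proof.
move=> /minimal_sublinear[q [sq qp qmin]].
have qN x := minimal_sublinear_odd x sq qmin.
have qD x y : q (x + y) = q x + q y.
  apply/eqP; rewrite eq_le sq.1/=.
  by have := sq.1 (x + y) (- y); rewrite addrK qN; lra.
have qZ (c : R) x : q (c *: x) = c * q x.
  have [c0|c0|->] := ltrgt0P c; first exact: sq.2.
    rewrite -[c]opprK scaleNr qN sq.2 ?oppr_gt0//; lra.
  by rewrite scale0r (sublinear0 sq) mul0r.
have qlin : GRing.linear_for *%R q by move=> c x y; rewrite qD qZ.
pose F := GRing.isLinear.Build R E R *%R q qlin.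
pose f : {scalar E} := HB.pack q F.
by exists f => x; exact: qp.
Qed.

End Sublinear.

(** Applied to the norm itself, [linear_le_sublinear] gives no control at [x0];
    applied to the norm pushed down along [x0], it forces
    [f (- x0) <= - |x0|]. *)
Lemma norming_functional (R : realType) (E : normedModType R) (x0 : E) :
  exists f : {scalar E}, (forall x, `|f x| <= `|x|) /\ f x0 = `|x0|.
Proof.
have sn : sublinear (fun x : E => `|x|).
  split=> [x y|c x c0]; first exact: ler_normD.
  by rewrite normrZ gtr0_norm.
have [f flen] := linear_le_sublinear (sublinear_lower_chord x0 sn).
have fn x : f x <= `|x| by exact: le_trans (flen x) (lower_chord_le_id _ _ sn).
exists f; split=> [x|].
  by rewrite ler_norml fn andbT lerNl -raddfN -normrN fn.
apply/eqP; rewrite eq_le fn/= -lerN2 -raddfN.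
exact: le_trans (flen _) (lower_chord_opp _ sn).
Qed.

(** * Functions generated by characters *)

Lemma bernoulli_le (R : realFieldType) (h : R) (n : nat) :
  -1 <= h -> 1 + n%:R * h <= (1 + h) ^+ n.
Proof.
move=> h1; elim: n => [|n ih]; first by rewrite mul0r addr0 expr0.
rewrite exprS (le_trans _ (ler_wpM2l _ ih)) -?lerBlDl ?sub0r//.
rewrite mulrDr mulr1 mulrDl mul1r !mulrA.
have : 0 <= n%:R * h * h by rewrite -mulrA mulr_ge0 // -expr2 sqr_ge0.
rewrite -natr1; nra.
Qed.

Lemma cvg_natr_exp (R : realType) (r : R) : 0 <= r < 1 ->
  n%:R * r ^+ n @[n --> \oo] --> (0 : R).
Proof.
move=> /andP[r0 r1].
have [->|rn0] := eqVneq r 0.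
  apply: cvg_near_cst; near=> n.
  have n0 : (0 < n)%N by near: n; exists 1%N.
  by rewrite expr0n gtn_eqF// mulr0.
have rp : 0 < r by rewrite lt_neqAle eq_sym rn0.
(* With h = 1/s - 1, Bernoulli's inequality gives n s^n <= 1/h, hence
   n r^n <= s^n / h. *)
pose s := Num.sqrt r.
have s0 : 0 < s by rewrite sqrtr_gt0.
have sr : s ^+ 2 = r by rewrite sqr_sqrtr.
have s1 : s < 1 by nra.
have h0 : 0 < s^-1 - 1 by rewrite subr_gt0 invf_gt1.
apply: (@squeeze_cvgr _ _ _ _ (fun=> 0) (geometric (s^-1 - 1)^-1 s)).
- near=> n; rewrite mulr_ge0 ?exprn_ge0//= -sr -exprM mulnC exprM expr2 mulrA.
  rewrite ler_wpM2r ?exprn_ge0 ?(ltW s0)// -[leRHS]mul1r ler_pdivlMr//.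
  have : 1 + n%:R * (s^-1 - 1) <= (s ^+ n)^-1.
    have := @bernoulli_le _ (s^-1 - 1) n; rewrite addrCA subrr addr0 exprVn.
    by apply; lra.
  have sn0 : 0 < s ^+ n by rewrite exprn_gt0.
  by rewrite -[leRHS]div1r ler_pdivlMr//; lra.
- exact: cvg_cst.
- by apply: cvg_geometric; rewrite gtr0_norm.
Unshelve. all: by end_near. Qed.

(** Polynomials converging boundedly on [[0, 1]] to a step function.  By
    Bernoulli's inequality the [n]-th one is at least [1 - n (2 t)^n], and at
    most [1 / (1 + n (2 t)^n)].  The factor [n] in the exponent serves the point
    [t = 1/2], where [(1 - t^n)^(2^n)] would tend to [1/e] instead of [0]. *)
Lemma cvg_half_step (R : realType) (t : R) : 0 <= t <= 1 ->
  (1 - t ^+ n) ^+ (n * 2 ^ n) @[n --> \oo] --> ((t < 2^-1)%R%:R : R).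
Proof.
move=> /andP[t0 t1].
have tn n : 0 <= t ^+ n <= 1 by rewrite exprn_ge0// exprn_ile1.
have E n : (n * 2 ^ n)%:R * t ^+ n = n%:R * (2 * t) ^+ n.
  by rewrite natrM natrX exprMn mulrA.
have [th|th] := ltP t 2^-1.
  apply: (@squeeze_cvgr _ _ _ _ (fun n => 1 - n%:R * (2 * t) ^+ n) (fun=> 1)).
  - near=> n; apply/andP; split; last by rewrite exprn_ile1//; have := tn n; lra.
    have := @bernoulli_le _ (- t ^+ n) (n * 2 ^ n); rewrite mulrN E; apply.
    by have := tn n; lra.
  - rewrite -[X in _ --> X]subr0; apply: cvgB; first exact: cvg_cst.
    by apply: cvg_natr_exp; lra.
  - exact: cvg_cst.
apply: (@squeeze_cvgr _ _ _ _ (fun=> 0) (fun n => n.+1%:R^-1)).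
- near=> n; rewrite exprn_ge0 /=; last by have := tn n; lra.
  rewrite -[leRHS]mul1r ler_pdivlMr//.
  apply: (@le_trans _ _ (((1 - t ^+ n) * (1 + t ^+ n)) ^+ (n * 2 ^ n))).
    rewrite [leRHS]exprMn ler_wpM2l ?exprn_ge0//; first by have := tn n; lra.
    apply: le_trans (bernoulli_le _ _); last by have := tn n; lra.
    rewrite E -natr1 addrC lerD2l ler_peMr// exprn_ege1//; lra.
  by have := tn n => /andP[a b]; rewrite exprn_ile1//; nra.
- exact: cvg_cst.
- exact: cvg_harmonic.
Unshelve. all: by end_near. Qed.

(** Being inductive, this class comes with the principle needed below: an
    assertion about integrals that holds for characters and is stable under
    linear combinations and bounded limits holds on the whole class. *)
Inductive trig_closed (R : realType) (E : normedModType R) : (E -> R) -> Prop :=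
| trig_closed_cos (f : {scalar E}) of continuous f :
    trig_closed (fun x => cos (f x))
| trig_closed_sin (f : {scalar E}) of continuous f :
    trig_closed (fun x => sin (f x))
| trig_closed_lin (a : R) u v of trig_closed u & trig_closed v :
    trig_closed (fun x => a * u x + v x)
| trig_closed_lim (u : nat -> E -> R) (l : E -> R) (M : R)
    of (forall n, trig_closed (u n)) & (forall n x, `|u n x| <= M) &
       (forall x, u n x @[n --> \oo] --> l x) :
    trig_closed l.

Section TrigClosed.
Context (R : realType) (E : normedModType R).
Implicit Types (u v : E -> R) (A : set E).

Lemma continuous_scalarD (f g : {scalar E}) : continuous f -> continuous g ->
  continuous (f \+ g).
Proof. by move=> cf cg x; apply: cvgD; [exact: cf|exact: cg]. Qed.

Lemma continuous_scalarB (f g : {scalar E}) : continuous f -> continuous g ->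
  continuous (f \- g).
Proof. by move=> cf cg x; apply: cvgB; [exact: cf|exact: cg]. Qed.

Lemma continuous_scalarZ (a : R) (f : {scalar E}) : continuous f ->
  continuous (a \*o f).
Proof. by move=> cf x; apply: cvgZr; exact: cf. Qed.

Lemma trig_closed_bounded u : trig_closed u -> exists M, forall x, `|u x| <= M.
Proof.
elim=> [f cf|f cf|a v w _ [M vM] _ [N wN]|v l M _ _ vM vl].
- by exists 1 => x; rewrite cos_max.
- by exists 1 => x; rewrite sin_max.
- exists (`|a| * M + N) => x.
  by rewrite (le_trans (ler_normD _ _))// lerD// normrM ler_wpM2l.
- exists M => x.
  have vlx : `|v n x| @[n --> \oo] --> `|l x| by exact: cvg_norm (vl x).
  rewrite -(cvg_lim _ vlx)//; apply: limr_le; first by apply: cvgP vlx.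
  by near=> n.
Unshelve. all: by end_near. Qed.

Lemma trig_closed_cst (a : R) : trig_closed (fun _ : E => a).
Proof.
have c0 : continuous (\0 : {scalar E}) by move=> x; exact: cvg_cst.
have := trig_closed_lin (a - 1) (trig_closed_cos c0) (trig_closed_cos c0).
by congr trig_closed; apply/funext => x /=; rewrite cos0; ring.
Qed.

Lemma trig_closedZ (a : R) u : trig_closed u -> trig_closed (fun x => a * u x).
Proof.
move=> tu; have := trig_closed_lin a tu (trig_closed_cst 0).
by congr trig_closed; apply/funext => x /=; rewrite addr0.
Qed.

Lemma trig_closedD u v :
  trig_closed u -> trig_closed v -> trig_closed (fun x => u x + v x).
Proof.
move=> tu tv; have := trig_closed_lin 1 tu tv.
by congr trig_closed; apply/funext => x /=; rewrite mul1r.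
Qed.

Lemma trig_closedB u v :
  trig_closed u -> trig_closed v -> trig_closed (fun x => u x - v x).
Proof.
move=> tu tv; have := trig_closed_lin (-1) tv tu.
by congr trig_closed; apply/funext => x /=; ring.
Qed.

Let trig_closed_mul_pres w : (exists M, forall x, `|w x| <= M) ->
  (forall f : {scalar E}, continuous f -> trig_closed (fun x => cos (f x) * w x)) ->
  (forall f : {scalar E}, continuous f -> trig_closed (fun x => sin (f x) * w x)) ->
  forall u, trig_closed u -> trig_closed (fun x => u x * w x).
Proof.
move=> [N wN] hc hs u; elim=> [f cf|f cf|a v v' _ ihv _ ihv'|v l M tv ihv vM vl].
- exact: hc.
- exact: hs.
- have := trig_closed_lin a ihv ihv'.
  by congr trig_closed; apply/funext => x /=; ring.
- apply: (@trig_closed_lim _ _ (fun n x => v n x * w x) _ (M * N)) => //.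
  + by move=> n x; rewrite normrM ler_pM.
  + by move=> x; apply: cvgM => //; exact: cvg_cst.
Qed.

(** Products of two characters are given by the product-to-sum formulas; the
    general case follows by induction on one factor, then on the other. *)
Lemma trig_closedM u v :
  trig_closed u -> trig_closed v -> trig_closed (fun x => u x * v x).
Proof.
have comm w w' : trig_closed (fun x => w x * w' x) ->
    trig_closed (fun x => w' x * w x).
  by congr trig_closed; apply/funext => x; rewrite mulrC.
have half (w1 w2 w : E -> R) (a : R) : trig_closed w1 -> trig_closed w2 ->
    (forall x, w1 x + a * w2 x = 2 * w x) -> trig_closed w.
  move=> t1 t2 e.
  have := trig_closedZ 2^-1 (trig_closedD t1 (trig_closedZ a t2)).
  by congr trig_closed; apply/funext => x; rewrite e; field.
have tD (f g : {scalar E}) (cf : continuous f) (cg : continuous g) :=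
  trig_closed_cos (f := f \+ g) (continuous_scalarD cf cg).
have tB (f g : {scalar E}) (cf : continuous f) (cg : continuous g) :=
  trig_closed_cos (f := f \- g) (continuous_scalarB cf cg).
have sD (f g : {scalar E}) (cf : continuous f) (cg : continuous g) :=
  trig_closed_sin (f := f \+ g) (continuous_scalarD cf cg).
have sB (f g : {scalar E}) (cf : continuous f) (cg : continuous g) :=
  trig_closed_sin (f := f \- g) (continuous_scalarB cf cg).
have cu (f : {scalar E}) u' : continuous f -> trig_closed u' ->
    trig_closed (fun x => cos (f x) * u' x).
  move=> cf tu'; apply: comm; apply: trig_closed_mul_pres tu'.
  - by exists 1 => x; rewrite cos_max.
  - move=> g cg; apply: half (tD _ _ cg cf) (tB _ _ cg cf) (_ : forall x, _ + 1 * _ = _).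
    by move=> x /=; rewrite cosB cosD; ring.
  - move=> g cg; apply: half (sD _ _ cg cf) (sB _ _ cg cf) (_ : forall x, _ + 1 * _ = _).
    by move=> x /=; rewrite sinB sinD; ring.
have su (f : {scalar E}) u' : continuous f -> trig_closed u' ->
    trig_closed (fun x => sin (f x) * u' x).
  move=> cf tu'; apply: comm; apply: trig_closed_mul_pres tu'.
  - by exists 1 => x; rewrite sin_max.
  - move=> g cg; apply: half (sD _ _ cg cf) (sB _ _ cg cf) (_ : forall x, _ + (-1) * _ = _).
    by move=> x /=; rewrite sinB sinD; ring.
  - move=> g cg; apply: half (tB _ _ cg cf) (tD _ _ cg cf) (_ : forall x, _ + (-1) * _ = _).
    by move=> x /=; rewrite cosB cosD; ring.
move=> tu tv; apply: trig_closed_mul_pres tu.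
- exact: trig_closed_bounded tv.
- by move=> f cf; exact: cu.
- by move=> f cf; exact: su.
Qed.

Lemma trig_closedX u n : trig_closed u -> trig_closed (fun x => u x ^+ n).
Proof.
move=> tu; elim: n => [|n ih]; first exact: trig_closed_cst.
have := trig_closedM tu ih.
by congr trig_closed; apply/funext => x; rewrite exprS.
Qed.

End TrigClosed.

Section TrigClosedSets.
Context (R : realType) (E : normedModType R).
Implicit Types (u v : E -> R) (A : set E).

Lemma trig_closed_indicC A :
  trig_closed (\1_A : E -> R) -> trig_closed (\1_(~` A) : E -> R).
Proof.
move=> tA; have := trig_closedB (trig_closed_cst E 1) tA.
congr trig_closed; apply/funext => x; rewrite indicC indicE.
by case: (x \in A); rewrite ?subrr ?subr0.
Qed.

Lemma trig_closed_indicI A C : trig_closed (\1_A : E -> R) ->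
  trig_closed (\1_C : E -> R) -> trig_closed (\1_(A `&` C) : E -> R).
Proof.
by move=> tA tC; have := trig_closedM tA tC; rewrite indicI.
Qed.

Lemma trig_closed_indicU A C : trig_closed (\1_A : E -> R) ->
  trig_closed (\1_C : E -> R) -> trig_closed (\1_(A `|` C) : E -> R).
Proof.
move=> tA tC; rewrite -[A `|` C]setCK setCU; apply: trig_closed_indicC.
by apply: trig_closed_indicI; exact: trig_closed_indicC.
Qed.

Lemma indic_cvg T (A : nat -> set T) (L : set T) (x : T) :
  (\forall n \near \oo, A n x <-> L x) ->
  \1_(A n) x @[n --> \oo] --> (\1_L x : R).
Proof.
move=> AL; apply: cvg_near_cst; near=> n.
have nx : A n x <-> L x by near: n.
rewrite !indicE; congr (_%:R); congr nat_of_bool.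
by apply/idP/idP; rewrite !inE => /nx.
Unshelve. all: by end_near. Qed.

Lemma indic_norm_le1 T (A : set T) (x : T) : `|\1_A x : R| <= 1.
Proof. by rewrite indicE; case: (x \in A); rewrite ?normr0 ?normr1. Qed.

Lemma trig_closed_indic_bigcup (F : nat -> set E) :
  (forall n, trig_closed (\1_(F n) : E -> R)) ->
  trig_closed (\1_(\bigcup_n F n) : E -> R).
Proof.
move=> tF.
apply: (@trig_closed_lim _ _ (fun n => \1_(\big[setU/set0]_(i < n) F i)) _ 1).
- elim=> [|n ih]; last by rewrite big_ord_recr; exact: trig_closed_indicU.
  rewrite big_ord0 [X in trig_closed X](_ : _ = cst 0); first exact: trig_closed_cst.
  by apply/funext => x; rewrite indicE in_set0.
- by move=> n x; exact: indic_norm_le1.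
- move=> x; apply: indic_cvg.
  have [[m _ Fmx]|nF] := pselect ((\bigcup_n F n) x).
    near=> n; split=> _; first by exists m.
    rewrite -bigcup_mkord; exists m => //=.
    by near: n; exists m.+1.
  near=> n; split=> [|/nF//]; rewrite -bigcup_mkord => -[m _ Fmx].
  by exfalso; apply: nF; exists m.
Unshelve. all: by end_near. Qed.

(** The indicator is a bounded limit of polynomials in [u], by
    [cvg_half_step]. *)
Lemma trig_closed_lt_half u : trig_closed u -> (forall x, 0 <= u x <= 1) ->
  trig_closed (\1_[set x | u x < 2^-1] : E -> R).
Proof.
move=> tu u01.
apply: (@trig_closed_lim _ _ (fun n x => (1 - u x ^+ n) ^+ (n * 2 ^ n)) _ 1).
- move=> n; apply: trig_closedX; apply: trig_closedB; first exact: trig_closed_cst.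
  exact: trig_closedX.
- move=> n x; have /andP[u0 u1] := u01 x.
  have un : 0 <= 1 - u x ^+ n <= 1.
    have : u x ^+ n <= 1 by rewrite exprn_ile1.
    by have : 0 <= u x ^+ n by [rewrite exprn_ge0]; lra.
  by move/andP : un => [un0 un1]; rewrite ger0_norm ?exprn_ge0// exprn_ile1.
- move=> x; have := cvg_half_step (u01 x).
  rewrite indicE (_ : (x \in _) = (u x < 2^-1))//.
  by apply/idP/idP; rewrite inE.
Qed.

(** For [n] large, depending on [x], the number [(f x - c) / n] lies in
    [(-pi, pi)], where it has the sign of its sine.  Hence the indicators of
    [sin ((f - c) / n) < 0] converge pointwise to the one of [f < c]. *)
Lemma trig_closed_halfspace (f : {scalar E}) (c : R) : continuous f ->
  trig_closed (\1_[set x | f x < c] : E -> R).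
Proof.
move=> cf.
pose a n (x : E) : R := n.+1%:R^-1 * (f x - c).
pose u n (x : E) : R := (1 + sin (a n x)) / 2.
apply: (@trig_closed_lim _ _ (fun n => \1_[set x | u n x < 2^-1]) _ 1).
- move=> n; apply: trig_closed_lt_half => [|x]; last first.
    by have := sin_geN1 (a n x); have := sin_le1 (a n x); rewrite /u; lra.
  pose g : {scalar E} := n.+1%:R^-1 \*o f.
  have cg : continuous g by exact: continuous_scalarZ.
  have := trig_closedZ 2^-1 (trig_closedD (trig_closed_cst E 1)
    (trig_closedB (trig_closedZ (cos (n.+1%:R^-1 * c)) (trig_closed_sin cg))
                  (trig_closedZ (sin (n.+1%:R^-1 * c)) (trig_closed_cos cg)))).
  congr trig_closed; apply/funext => x.
  by rewrite /u /a mulrBr sinB /=; field.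
- by move=> n x; exact: indic_norm_le1.
- move=> x; apply: indic_cvg; near=> n.
  have hn : `|f x - c| < n.+1%:R.
    near: n; exists (Num.truncn `|f x - c|) => //= n /=.
    move=> h; apply: lt_le_trans (truncnS_gt _) _.
    by rewrite ler_nat.
  have n0 : 0 < n.+1%:R^-1 :> R by rewrite invr_gt0.
  have an : `|a n x| < pi.
    rewrite /a normrM gtr0_norm// mulrC ltr_pdivrMr// (lt_le_trans hn)//.
    by rewrite ler_peMl//; have := pi_ge2 R; lra.
  have uE : (u n x < 2^-1) = (sin (a n x) < 0) by rewrite /u; apply/idP/idP; lra.
  have aE : (a n x < 0) = (f x < c) by rewrite /a pmulr_rlt0// subr_lt0.
  rewrite /= uE -aE; move: an; rewrite ltr_norml => /andP[an1 an2].
  have [a0|a0|->] := ltgtP (a n x) 0; last by rewrite sin0 ltxx.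
    split=> // _; rewrite -oppr_gt0 -sinN sin_gt0_pi//; apply/andP; split; lra.
  split=> // s0; have := @sin_gt0_pi R (a n x).
  by rewrite a0 an2 => /(_ isT); lra.
Unshelve. all: by end_near. Qed.

Lemma trig_closed_le_halfspace (f : {scalar E}) (c : R) : continuous f ->
  trig_closed (\1_[set x | f x <= c] : E -> R).
Proof.
move=> cf; have cNf : continuous (\- f : {scalar E}).
  by move=> x; apply: cvgN; exact: cf.
have := trig_closed_indicC (@trig_closed_halfspace (\- f : {scalar E}) (- c) cNf).
congr (trig_closed (\1_ _)); apply/seteqP.
by split=> x /=; rewrite ltrN2 leNgt => /negP.
Qed.

End TrigClosedSets.

Lemma separable_seq (R : realType) (E : normedModType R) : separable E ->
  exists D : nat -> E, forall (x : E) (e : R), 0 < e -> exists n, `|x - D n| < e.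
Proof.
move=> [D cD dD].
have [D0|[g]] := pfcard_geP cD.
  have [x [_]] := dD setT (ex_intro _ 0 I) openT.
  by rewrite D0.
exists g => x e e0.
have [y [yx Dy]] := dD (ball x e) (ex_intro _ x (ballxx x e0)) (ball_open x e).
have [n _ gn] := (@surj _ _ _ _ g) y Dy.
by exists n; rewrite gn; move: yx; rewrite -ball_normE.
Qed.

Lemma scalar_bounded_continuous (K : numFieldType) (E : normedModType K)
    (f : {scalar E}) (C : K) :
  0 < C -> (forall x, `|f x| <= C * `|x|) -> continuous f.
Proof.
move=> C0 fC x; apply/cvgrPdist_lt => e e0.
near=> y; rewrite -linearB /= (le_lt_trans (fC _))//.
rewrite mulrC -ltr_pdivlMr//.
near: y; apply/nbhs_normP; exists (e / C) => //=.
by rewrite divr_gt0.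
Unshelve. all: by end_near. Qed.

Lemma scalar_continuous_bounded (K : numFieldType) (E : normedModType K)
    (f : {scalar E}) :
  continuous f -> exists2 C : K, 0 < C & forall x, `|f x| <= C * `|x|.
Proof.
move=> /(_ 0)/cvgrPdist_lt/(_ 1 ltr01)/nbhs_normP[e /= e0 eE].
exists (2 / e); first by rewrite divr_gt0.
move=> x; have [->|x0] := eqVneq x 0; first by rewrite raddf0 !normr0 mulr0.
have nx : 0 < `|x| by rewrite normr_gt0.
pose c := e / (2 * `|x|).
have c0 : 0 < c by rewrite divr_gt0// mulr_gt0.
have := eE (c *: x).
rewrite /ball_/= sub0r normrN normrZ gtr0_norm// raddf0 sub0r normrN linearZ /=.
rewrite normrM gtr0_norm//.
have -> : c * `|x| = e / 2 by rewrite /c; field; rewrite gt_eqF.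
rewrite [e / 2 < e]ltr_pdivrMr// ltr_pMr// ltr1n => /(_ isT) h.
have : `|f x| < c^-1 by rewrite -[c^-1]mul1r ltr_pdivlMr// mulrC.
by rewrite /c invf_div mulrAC => /ltW.
Qed.

Section SeparableBorel.
Context (R : realType) (E : normedModType R).
Context (sepE : separable E).

(** The norm of a separable space is the supremum of countably many functionals
    [f n] of norm at most one, where [f n] norms the [n]-th point of a dense
    sequence; a closed ball is thus a countable intersection of half-spaces. *)
Lemma trig_closed_ball (a : E) (r : R) :
  trig_closed (\1_[set x | `|x - a| <= r] : E -> R).
Proof.
have [D Dd] := separable_seq sepE.
have /choice[f fP] (n : nat) : exists f : {scalar E},
  (forall x, `|f x| <= `|x|) /\ f (D n) = `|D n| by exact: norming_functional.
have cf n : continuous (f n).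
  by apply: (scalar_bounded_continuous ltr01) => x; rewrite mul1r (fP n).1.
have -> : [set x | `|x - a| <= r] =
    ~` (\bigcup_n ~` [set x | f n x <= r + f n a]).
  rewrite setC_bigcup; under eq_bigcapr do rewrite setCK.
  apply/seteqP; split=> x /=.
    move=> xa n _ /=; rewrite -lerBlDr -raddfB.
    by apply: le_trans xa; apply: le_trans (ler_norm _) ((fP n).1 _).
  move=> h; apply/ler_addgt0Pr => e e0.
  have e2 : 0 < e / 2 by rewrite divr_gt0.
  have [n xn] := Dd (x - a) _ e2.
  have := h n I; rewrite /= -lerBlDr -raddfB => fn.
  have := (fP n).1 (x - a - D n); rewrite raddfB/= (fP n).2.
  have := ler_normD (x - a - D n) (D n); rewrite subrK.
  by have := ler_norm (- (f n (x - a) - `|D n|)); rewrite normrN; lra.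
apply: trig_closed_indicC; apply: trig_closed_indic_bigcup => n.
by apply: trig_closed_indicC; exact: trig_closed_le_halfspace.
Qed.

Lemma trig_closed_open (O : set E) : open O -> trig_closed (\1_O : E -> R).
Proof.
move=> oO; have [D Dd] := separable_seq sepE.
(* An open set is the union of the balls with centre D n and radius 1/(k+1)
   that it contains; F keeps the good pairs (n, k). *)
pose C n k := [set x : E | `|x - D n| <= k.+1%:R^-1].
pose F n k := if pselect (C n k `<=` O) then C n k else set0.
have -> : O = \bigcup_n \bigcup_k F n k.
  apply/seteqP; split=> [x Ox|x [n _ [k _]]]; last first.
    by rewrite /F; case: pselect => // CO /CO.
  have /nbhs_ballP[e /= e0 xeO] : nbhs x O by exact: open_nbhs_nbhs.
  have [k ke] : exists k, k.+1%:R^-1 < e / 2 :> R.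
    exists (Num.truncn (e / 2)^-1); rewrite invf_plt ?posrE ?divr_gt0//.
    exact: truncnS_gt.
  have k0 : 0 < k.+1%:R^-1 :> R by rewrite invr_gt0.
  have [n xn] := Dd x _ k0.
  exists n => //; exists k => //; rewrite /F; case: pselect => [?|]; first exact: ltW.
  case=> y; rewrite /C /= => yn; apply: xeO; rewrite -ball_normE /ball_/=.
  rewrite -(subrKA (D n)) (le_lt_trans (ler_normD _ _))// (splitr e) ltrD//.
    exact: lt_trans xn ke.
  by rewrite distrC (le_lt_trans yn).
apply: trig_closed_indic_bigcup => n; apply: trig_closed_indic_bigcup => k.
rewrite /F; case: pselect => ?; first exact: trig_closed_ball.
rewrite [X in trig_closed X](_ : _ = cst 0); first exact: trig_closed_cst.
by apply/funext => x; rewrite indicE in_set0.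
Qed.

Lemma trig_closed_borel (A : set (borel E)) : measurable A ->
  trig_closed (\1_(A : set E) : E -> R).
Proof.
move: A; apply: smallest_sub; last by move=> O; exact: trig_closed_open.
split.
- rewrite [X in trig_closed X](_ : _ = cst 0); first exact: trig_closed_cst.
  by apply/funext => x; rewrite indicE in_set0.
- by move=> A tA; rewrite setTD; exact: trig_closed_indicC.
- exact: trig_closed_indic_bigcup.
Qed.

End SeparableBorel.

(** * Integrals determined by characteristic functions *)

Section BoundedIntegrals.
Context d (T : measurableType d) (R : realType) (P : probability T R).
Implicit Types (u v : T -> R).

Lemma bounded_integrable u (M : R) : measurable_fun setT u ->
  (forall x, `|u x| <= M) -> P.-integrable setT (EFin \o u).
Proof.
move=> mu uM; apply: measurable_bounded_integrable => //.
  by rewrite (le_lt_trans (probability_le1 P _)) ?ltry.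
exists M; split; rewrite ?num_real// => N MN x _ /=.
exact: le_trans (uM x) (ltW MN).
Qed.

Lemma Rintegral_bounded_cvg (u : nat -> T -> R) (l : T -> R) (M : R) :
  (forall n, measurable_fun setT (u n)) -> (forall n x, `|u n x| <= M) ->
  (forall x, u n x @[n --> \oo] --> l x) ->
  \int[P]_x u n x @[n --> \oo] --> \int[P]_x l x.
Proof.
move=> mu uM ul.
have ml : measurable_fun setT l.
  by apply: (measurable_fun_cvg mu) => x _; exact: ul.
have lM x : `|l x| <= M.
  have ulx : `|u n x| @[n --> \oo] --> `|l x| by exact: cvg_norm (ul x).
  rewrite -(cvg_lim _ ulx)//; apply: limr_le; first by apply: cvgP ulx.
  by near=> n.
apply: fine_cvg; rewrite fineK; last first.
  by apply: integrable_fin_num => //; exact: bounded_integrable lM.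
apply: (@dominated_cvg _ _ _ _ _ _ (fun n => EFin \o u n) _ (cst M%:E)) => //.
- by move=> n; apply/measurable_EFinP.
- by move=> x _; apply/fine_cvgP; split; [near=> n|exact: ul].
- by apply: (@bounded_integrable (cst M) `|M|) => //.
- by move=> n x _; rewrite /= lee_fin uM.
Unshelve. all: by end_near. Qed.

End BoundedIntegrals.

Lemma continuous_borel_measurable (S S' : ptopologicalType) (f : S -> S') :
  continuous f -> measurable_fun setT (f : borel S -> borel S').
Proof.
move=> /continuousP cf.
apply: (@measurability _ _ (borel S) (borel S') setT f (@open S') erefl).
move=> _ [U oU <-].
by rewrite setTI; apply: sub_sigma_algebra; exact: cf.
Qed.

Lemma continuous_borel_real_measurable (R : realType) (S : ptopologicalType)
    (f : S -> R) : continuous f -> measurable_fun setT (f : borel S -> R).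
Proof.
move=> /continuousP cf.
apply: (measurability _ (RGenOpens.measurableE R)) => _ [_ [a [b ->]] <-].
rewrite setTI; apply: sub_sigma_algebra; apply: cf; exact: interval_open.
Qed.

Section TrigClosedIntegral.
Context (R : realType) (E : normedModType R).

Lemma trig_closed_measurable (u : E -> R) :
  trig_closed u -> measurable_fun setT (u : borel E -> R).
Proof.
elim=> [f cf|f cf|a v w _ mv _ mw|v l M _ mv vM vl].
- apply: (@measurableT_comp _ _ _ _ _ _ (@cos R)).
    by apply: continuous_measurable_fun; exact: continuous_cos.
  exact: continuous_borel_real_measurable.
- apply: (@measurableT_comp _ _ _ _ _ _ (@sin R)).
    by apply: continuous_measurable_fun; exact: continuous_sin.
  exact: continuous_borel_real_measurable.
- by apply: measurable_funD => //; exact: measurable_funM.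
- by apply: (measurable_fun_cvg mv) => x _; exact: vl.
Qed.

(** The weights [W] and [W'] let this lemma serve twice: with constant weights
    it compares two laws, and with [W] a function of a second variable it turns
    factorization of characteristic functions into independence. *)
Lemma trig_closed_integral_eq d d' (T : measurableType d) (T' : measurableType d')
    (P : probability T R) (P' : probability T' R)
    (X : T -> borel E) (X' : T' -> borel E) (W : T -> R) (W' : T' -> R) (M : R) :
  measurable_fun setT X -> measurable_fun setT X' ->
  measurable_fun setT W -> measurable_fun setT W' ->
  (forall w, `|W w| <= M) -> (forall w, `|W' w| <= M) ->
  (forall f : {scalar E}, continuous f ->
    \int[P]_w (cos (f (X w)) * W w) = \int[P']_w (cos (f (X' w)) * W' w)) ->
  (forall f : {scalar E}, continuous f ->
    \int[P]_w (sin (f (X w)) * W w) = \int[P']_w (sin (f (X' w)) * W' w)) ->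
  forall u : E -> R, trig_closed u ->
    \int[P]_w (u (X w) * W w) = \int[P']_w (u (X' w) * W' w).
Proof.
move=> mX mX' mW mW' WM W'M hc hs.
have mul_meas (u : E -> R) : trig_closed u ->
    measurable_fun setT (fun w => u (X w) * W w) /\
    measurable_fun setT (fun w => u (X' w) * W' w).
  move=> /trig_closed_measurable mu.
  by split; apply: measurable_funM => //; apply: measurableT_comp.
have mul_int (u : E -> R) : trig_closed u ->
    P.-integrable setT (EFin \o (fun w => u (X w) * W w)) /\
    P'.-integrable setT (EFin \o (fun w => u (X' w) * W' w)).
  move=> tu; have [m m'] := mul_meas _ tu.
  have [N uN] := trig_closed_bounded tu.
  by split; [apply: (bounded_integrable (M := N * M) P m)|
             apply: (bounded_integrable (M := N * M) P' m')] => x;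
    rewrite normrM ler_pM.
move=> u; elim=> [f cf|f cf|a v w tv ihv tw ihw|v l N tv ihv vN vl].
- exact: hc.
- exact: hs.
- have [iv iv'] := mul_int _ tv; have [iw iw'] := mul_int _ tw.
  have lin d0 (T0 : measurableType d0) (P0 : probability T0 R)
      (X0 : T0 -> borel E) (W0 : T0 -> R) :
      P0.-integrable setT (EFin \o (fun w => v (X0 w) * W0 w)) ->
      P0.-integrable setT (EFin \o (fun x => w (X0 x) * W0 x)) ->
      \int[P0]_x ((a * v (X0 x) + w (X0 x)) * W0 x) =
      a * \int[P0]_x (v (X0 x) * W0 x) + \int[P0]_x (w (X0 x) * W0 x).
    move=> i1 i2; rewrite -RintegralZl// -RintegralD//; last first.
      rewrite (_ : _ \o _ = (fun x => a%:E * (v (X0 x) * W0 x)%R%:E)%E)//.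
      exact: integrableZl.
    by apply: eq_Rintegral => x _; rewrite mulrDl mulrA.
  by rewrite !lin// ihv ihw.
- have cvgI d0 (T0 : measurableType d0) (P0 : probability T0 R)
      (X0 : T0 -> borel E) (W0 : T0 -> R) :
      (forall n, measurable_fun setT (fun w => v n (X0 w) * W0 w)) ->
      (forall w, `|W0 w| <= M) ->
      \int[P0]_x (v n (X0 x) * W0 x) @[n --> \oo] --> \int[P0]_x (l (X0 x) * W0 x).
    move=> m0 W0M; apply: (@Rintegral_bounded_cvg _ _ _ _ _ _ (N * M)) => //.
      by move=> n x; rewrite normrM ler_pM.
    by move=> x; apply: cvgM; [exact: vl|exact: cvg_cst].
  have l1 := cvgI _ _ P _ _ (fun n => (mul_meas _ (tv n)).1) WM.
  have l2 := cvgI _ _ P' _ _ (fun n => (mul_meas _ (tv n)).2) W'M.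
  rewrite -(cvg_lim _ l1)// -(cvg_lim _ l2)//.
  by under eq_fun do rewrite ihv.
Qed.

End TrigClosedIntegral.

Section CharacteristicFunctions.
Context (R : realType).

Lemma Rintegral_indic_preimage d d' (T : measurableType d)
    (T' : measurableType d') (P : probability T R) (X : T -> T') (A : set T') :
  measurable_fun setT X -> measurable A ->
  \int[P]_w (\1_A (X w)) = fine (P (X @^-1` A)).
Proof.
move=> mX mA; have mXA : measurable (X @^-1` A).
  by rewrite -[X @^-1` A]setTI; exact: mX.
rewrite /Rintegral; congr fine.
by have := integral_indic P measurableT mXA; rewrite setIT => <-.
Qed.

Context (E : normedModType R).
Context (sepE : separable E).

Lemma eq_law_of_char d d' (T : measurableType d) (T' : measurableType d')
    (P : probability T R) (P' : probability T' R)
    (X : T -> borel E) (X' : T' -> borel E) :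
  measurable_fun setT X -> measurable_fun setT X' ->
  (forall f : {scalar E}, continuous f ->
    complex_integral P (fun w => expi (f (X w))) =
    complex_integral P' (fun w => expi (f (X' w)))) ->
  forall A : set (borel E), measurable A ->
    P (X @^-1` A) = P' (X' @^-1` A).
Proof.
move=> mX mX' XX' A mA.
have mpre d0 (T0 : measurableType d0) (X0 : T0 -> borel E) :
    measurable_fun setT X0 -> measurable (X0 @^-1` A).
  by move=> mX0; rewrite -[_ @^-1` _]setTI; exact: mX0.
have mul1 d0 (T0 : measurableType d0) (P0 : probability T0 R) (u : T0 -> R) :
    \int[P0]_w (u w * 1) = \int[P0]_w u w.
  by under eq_Rintegral do rewrite mulr1.
have := @trig_closed_integral_eq R E _ _ T T' P P' X X' (cst 1) (cst 1) 1
  mX mX' (measurable_cst _) (measurable_cst _) _ _ _ _ _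
  (trig_closed_borel sepE mA).
rewrite !mul1 !Rintegral_indic_preimage// => /(_ _ _ _ _)/wrap[]; rewrite ?normr1//.
- by move=> w; rewrite /= normr1.
- by move=> w; rewrite /= normr1.
- by move=> f cf; rewrite !mul1; have [] := XX' _ cf.
- by move=> f cf; rewrite !mul1; have [] := XX' _ cf.
move=> h; rewrite -[LHS]fineK ?fin_num_measure ?h ?fineK ?fin_num_measure//;
  exact: mpre.
Qed.

(** Independence is reached by two extensions from characters to indicators:
    first in [X], the weight being a trigonometric function of [Y], then in [Y],
    the weight being the indicator of a Borel set at [X]. *)
Lemma independent_of_char d (T : measurableType d) (P : probability T R)
    (X Y : T -> borel E) :
  measurable_fun setT X -> measurable_fun setT Y ->
  (forall f g : {scalar E}, continuous f -> continuous g ->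
    complex_integral P (fun w => expi (f (X w) + g (Y w))) =
    complex_integral P (fun w => expi (f (X w))) *
    complex_integral P (fun w => expi (g (Y w)))) ->
  independent P X Y.
Proof.
move=> mX mY XY A C mA mC.
have tm (u : E -> R) (Z : T -> borel E) : trig_closed u ->
    measurable_fun setT Z -> measurable_fun setT (fun w => u (Z w)).
  by move=> /trig_closed_measurable mu mZ; exact: measurableT_comp.
have tb (u : E -> R) (Z : T -> borel E) : trig_closed u ->
    exists M, forall w, `|u (Z w)| <= M.
  by move=> /trig_closed_bounded[M uM]; exists M.
have tint (u : E -> R) (Z : T -> borel E) : trig_closed u ->
    measurable_fun setT Z -> P.-integrable setT (EFin \o (fun w => u (Z w))).
  move=> tu mZ; have [M uM] := tb u Z tu.
  by apply: (bounded_integrable P (M := M)) => //; exact: tm tu mZ.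
pose EP (u : T -> R) := \int[P]_w u w.
(* Adding and subtracting the hypothesis at g and at - g isolates the integrals
   of the four products of a cosine or sine of f X and one of g Y. *)
have char4 (f g : {scalar E}) : continuous f -> continuous g ->
  [/\ EP (fun w => cos (f (X w)) * cos (g (Y w))) =
        EP (fun w => cos (f (X w))) * EP (fun w => cos (g (Y w))),
      EP (fun w => sin (f (X w)) * cos (g (Y w))) =
        EP (fun w => sin (f (X w))) * EP (fun w => cos (g (Y w))),
      EP (fun w => cos (f (X w)) * sin (g (Y w))) =
        EP (fun w => cos (f (X w))) * EP (fun w => sin (g (Y w))) &
      EP (fun w => sin (f (X w)) * sin (g (Y w))) =
        EP (fun w => sin (f (X w))) * EP (fun w => sin (g (Y w)))].
  move=> cf cg.
  have cNg : continuous (\- g : {scalar E}) by move=> x; apply: cvgN; exact: cg.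
  have pint (u v : E -> R) : trig_closed u -> trig_closed v ->
      P.-integrable setT (EFin \o (fun w => u (X w) * v (Y w))).
    move=> tu tv; have [M uM] := tb u X tu; have [N vN] := tb v Y tv.
    apply: (bounded_integrable P (M := M * N)).
      by apply: measurable_funM; [exact: tm tu mX|exact: tm tv mY].
    by move=> w; rewrite normrM ler_pM.
  have tc := trig_closed_cos cf; have ts := trig_closed_sin cf.
  have tc' := trig_closed_cos cg; have ts' := trig_closed_sin cg.
  have [] := XY _ _ cf cg; have [] := XY _ _ cf cNg.
  rewrite /= -!/(EP _).
  have -> : EP (fun w => cos (- g (Y w))) = EP (fun w => cos (g (Y w))).
    by apply: eq_Rintegral => w _; rewrite cosN.
  have -> : EP (fun w => sin (- g (Y w))) = - EP (fun w => sin (g (Y w))).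
    rewrite /EP -mulN1r -RintegralZl//; last exact: tint ts' mY.
    by apply: eq_Rintegral => w _; rewrite sinN mulN1r.
  have -> : EP (fun w => cos (f (X w) - g (Y w))) =
      EP (fun w => cos (f (X w)) * cos (g (Y w))) +
      EP (fun w => sin (f (X w)) * sin (g (Y w))).
    rewrite /EP -RintegralD//; [|exact: (pint _ _ tc tc')|exact: (pint _ _ ts ts')].
    by apply: eq_Rintegral => w _; rewrite cosB.
  have -> : EP (fun w => sin (f (X w) - g (Y w))) =
      EP (fun w => sin (f (X w)) * cos (g (Y w))) -
      EP (fun w => cos (f (X w)) * sin (g (Y w))).
    rewrite /EP -RintegralB//; [|exact: (pint _ _ ts tc')|exact: (pint _ _ tc ts')].
    by apply: eq_Rintegral => w _; rewrite sinB.
  have -> : EP (fun w => cos (f (X w) + g (Y w))) =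
      EP (fun w => cos (f (X w)) * cos (g (Y w))) -
      EP (fun w => sin (f (X w)) * sin (g (Y w))).
    rewrite /EP -RintegralB//; [|exact: (pint _ _ tc tc')|exact: (pint _ _ ts ts')].
    by apply: eq_Rintegral => w _; rewrite cosD.
  have -> : EP (fun w => sin (f (X w) + g (Y w))) =
      EP (fun w => sin (f (X w)) * cos (g (Y w))) +
      EP (fun w => cos (f (X w)) * sin (g (Y w))).
    rewrite /EP -RintegralD//; [|exact: (pint _ _ ts tc')|exact: (pint _ _ tc ts')].
    by apply: eq_Rintegral => w _; rewrite sinD.
  by move=> h1 h2 h3 h4; split; lra.
have factor (Z : T -> borel E) (W : T -> R) (M : R) :
    measurable_fun setT Z -> measurable_fun setT W -> (forall w, `|W w| <= M) ->
    (forall f : {scalar E}, continuous f ->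
      EP (fun w => cos (f (Z w)) * W w) = EP (fun w => cos (f (Z w))) * EP W) ->
    (forall f : {scalar E}, continuous f ->
      EP (fun w => sin (f (Z w)) * W w) = EP (fun w => sin (f (Z w))) * EP W) ->
    forall u : E -> R, trig_closed u ->
      EP (fun w => u (Z w) * W w) = EP (fun w => u (Z w)) * EP W.
  move=> mZ mW WM hc hs u tu.
  have cstE (v : E -> R) : trig_closed v ->
      \int[P]_w (v (Z w) * EP W) = EP (fun w => v (Z w)) * EP W.
    by move=> tv; rewrite RintegralZr//; exact: tint tv mZ.
  rewrite -cstE//.
  apply: (@trig_closed_integral_eq R E _ _ T T P P Z Z W (cst (EP W))
    (Num.max M `|EP W|)) => //.
  - by move=> w; rewrite le_max WM.
  - by move=> w; rewrite le_max lexx orbT.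
  - by move=> f cf; rewrite [RHS](cstE _ (trig_closed_cos cf)); exact: hc.
  - by move=> f cf; rewrite [RHS](cstE _ (trig_closed_sin cf)); exact: hs.
have tA := trig_closed_borel sepE mA; have tC := trig_closed_borel sepE mC.
have step (g : {scalar E}) : continuous g ->
    EP (fun w => cos (g (Y w)) * \1_A (X w)) =
      EP (fun w => cos (g (Y w))) * EP (fun w => \1_A (X w)) /\
    EP (fun w => sin (g (Y w)) * \1_A (X w)) =
      EP (fun w => sin (g (Y w))) * EP (fun w => \1_A (X w)).
  move=> cg; have tc := trig_closed_cos cg; have ts := trig_closed_sin cg.
  have swap (u v : T -> R) : EP (fun w => u w * v w) = EP (fun w => v w * u w).
    by apply: eq_Rintegral => w _; rewrite mulrC.
  split; rewrite swap [RHS]mulrC.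
  - apply: (@factor X (fun w => cos (g (Y w))) 1) => //; first exact: tm _ _ tc mY.
    + by move=> w; rewrite cos_max.
    + by move=> f cf; have [] := char4 _ _ cf cg.
    + by move=> f cf; have [] := char4 _ _ cf cg.
  - apply: (@factor X (fun w => sin (g (Y w))) 1) => //; first exact: tm _ _ ts mY.
    + by move=> w; rewrite sin_max.
    + by move=> f cf; have [] := char4 _ _ cf cg.
    + by move=> f cf; have [] := char4 _ _ cf cg.
have := @factor Y (fun w => \1_A (X w)) 1 mY (tm _ _ tA mX)
  (fun w => indic_norm_le1 _ _ _) (fun f cf => (step f cf).1)
  (fun f cf => (step f cf).2) _ tC.
have mXA : measurable (X @^-1` A) by rewrite -[_ @^-1` _]setTI; exact: mX.
have mYC : measurable (Y @^-1` C) by rewrite -[_ @^-1` _]setTI; exact: mY.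
rewrite /EP !Rintegral_indic_preimage//.
have -> : \int[P]_w (\1_C (Y w) * \1_A (X w)) =
    fine (P (X @^-1` A `&` Y @^-1` C)).
  have := @Rintegral_indic_preimage _ _ T T P id (X @^-1` A `&` Y @^-1` C).
  move=> /(_ (@measurable_id _ _ _) (measurableI _ _ mXA mYC)) /= <-.
  by apply: eq_Rintegral => w _; rewrite indicI /= mulrC.
move=> h.
rewrite -[LHS]fineK ?fin_num_measure//; last exact: measurableI.
by rewrite h EFinM !fineK ?fin_num_measure// muleC.
Qed.

End CharacteristicFunctions.

(** The joint law of [(X, Y)] is the product of the marginal laws, as the two
    agree on rectangles; Fubini's theorem then separates the integrals. *)
Lemma independent_Rintegral_prod (R : realType) d d' (T : measurableType d)
    (T' : measurableType d') (P : probability T R) (X Y : T -> T')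
    (u v : T' -> R) (M N : R) :
  measurable_fun setT X -> measurable_fun setT Y -> independent P X Y ->
  measurable_fun setT u -> measurable_fun setT v ->
  (forall x, `|u x| <= M) -> (forall x, `|v x| <= N) ->
  \int[P]_w (u (X w) * v (Y w)) =
  \int[P]_w u (X w) * \int[P]_w v (Y w).
Proof.
move=> mX mY iXY mu mv uM vN.
pose X' : {mfun T >-> T'} := HB.pack X (isMeasurableFun.Build _ _ _ _ X mX).
pose Y' : {mfun T >-> T'} := HB.pack Y (isMeasurableFun.Build _ _ _ _ Y mY).
have mXY : measurable_fun setT (fun w => (X w, Y w)) by exact: measurable_fun_pair.
pose XY : {mfun T >-> (T' * T')%type} :=
  HB.pack (fun w => (X w, Y w)) (isMeasurableFun.Build _ _ _ _ _ mXY).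
pose f (z : T' * T') : R := u z.1 * v z.2.
have mf : measurable_fun setT f.
  by apply: measurable_funM; apply: measurableT_comp.
have fMN z : `|f z| <= M * N by rewrite normrM ler_pM.
have joint : forall A, measurable A ->
    (distribution P X' \x distribution P Y')%E A = distribution P XY A.
  by move=> A mA; exact: product_measure_unique.
have int_dist (Z : {mfun T >-> T'}) (h : T' -> R) K : measurable_fun setT h ->
    (forall x, `|h x| <= K) ->
    \int[distribution P Z]_x h x = \int[P]_w h (Z w).
  move=> mh hK; rewrite /Rintegral; congr fine.
  rewrite -[RHS]/(\int[P]_w ((EFin \o h) \o Z) w)%E.
  apply: integral_distribution => //; first exact/measurable_EFinP.
  apply: (@bounded_integrable _ _ _ P (h \o Z) K); first exact: measurableT_comp.
  by move=> x; exact: hK.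
have int_XY : \int[P]_w (u (X w) * v (Y w)) = \int[distribution P XY]_z f z.
  rewrite /Rintegral; congr fine; apply/esym.
  rewrite -[RHS]/(\int[P]_w ((EFin \o f) \o XY) w)%E.
  apply: integral_distribution => //; first exact/measurable_EFinP.
  apply: (@bounded_integrable _ _ _ P (f \o XY) (M * N)).
    exact: measurableT_comp.
  by move=> w; exact: fMN.
have int_prod : \int[distribution P XY]_z f z =
    \int[(distribution P X' \x distribution P Y')%E]_z f z.
  rewrite /Rintegral; congr fine; apply: eq_measure_integral => A mA _.
  exact/esym/joint.
have fint : (distribution P X' \x distribution P Y')%E.-integrable setT (EFin \o f).
  exact: (bounded_integrable _ mf fMN).
have iv : (distribution P Y').-integrable setT (EFin \o v).
  exact: (bounded_integrable _ mv vN).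
have iu : (distribution P X').-integrable setT (EFin \o u).
  exact: (bounded_integrable _ mu uM).
rewrite int_XY int_prod.
rewrite -(int_dist X' u M)// -(int_dist Y' v N)// -RintegralZr//.
rewrite /Rintegral -integral12_prod_meas1//; congr fine.
apply: eq_integral => x _; rewrite /fubini_F /=.
under eq_integral do rewrite /f /= EFinM.
rewrite integralZl// EFinM fineK//.
exact: integrable_fin_num.
Qed.

(** * Real structure and real parts *)

Section ComplexAux.
Context (R : realType).
Implicit Types (a b : R[i]).

Lemma ReD a b : complex.Re (a + b) = complex.Re a + complex.Re b.
Proof. by case: a b => [? ?] [? ?]. Qed.

Lemma ReM a b : complex.Re (a * b) =
  complex.Re a * complex.Re b - complex.Im a * complex.Im b.
Proof. by case: a b => [? ?] [? ?]. Qed.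

Lemma Re_conjc a : complex.Re (conjc a) = complex.Re a.
Proof. by case: a. Qed.

Lemma Re_le a b : a <= b -> complex.Re a <= complex.Re b.
Proof. by rewrite lecE => /andP[]. Qed.

Lemma Re_normc_ge0 a : 0 <= complex.Re `|a|.
Proof. by rewrite normc_def /= sqrtr_ge0. Qed.

Lemma Re_normcK a : (complex.Re `|a|)%:C = `|a|.
Proof. by rewrite normc_def. Qed.

Lemma normr_Re_le a : `|complex.Re a| <= complex.Re `|a|.
Proof.
rewrite normc_def /= -sqrtr_sqr; apply: ler_wsqrtr.
by rewrite lerDl sqr_ge0.
Qed.

Lemma sqr_Re_normc a : complex.Re `|a| ^+ 2 = complex.Re a ^+ 2 + complex.Im a ^+ 2.
Proof. by rewrite normc_def /= sqr_sqrtr// addr_ge0 ?sqr_ge0. Qed.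

Lemma mulc_conj a : a * conjc a = (complex.Re `|a| ^+ 2)%:C.
Proof.
rewrite sqr_Re_normc; case: a => x y; apply/eqP; rewrite eq_complex /=.
by apply/andP; split; apply/eqP; ring.
Qed.

Lemma Re_real_mul (r : R) b : complex.Re (r%:C * b) = r * complex.Re b.
Proof. by rewrite ReM /= mul0r subr0. Qed.

End ComplexAux.

Section HilbertNorm.
Context (R : realType) (B : lmodType R[i]) (H : inner_product_subspace B).
Context (subH : is_linear_subspace H).
Context (ipH : is_inner_product (@conjc R) H).
Local Notation hn := (hnorm (@complex.Re R) H).
Implicit Types (x y z : B) (a : R[i]).

Lemma subspaceD x y : ips_set H x -> ips_set H y -> ips_set H (x + y).
Proof. by move=> Hx Hy; have := subH.2 1 _ _ Hx Hy; rewrite scale1r. Qed.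

Lemma subspaceZ a x : ips_set H x -> ips_set H (a *: x).
Proof. by move=> Hx; have := subH.2 a _ _ Hx subH.1; rewrite addr0. Qed.

Lemma subspaceB x y : ips_set H x -> ips_set H y -> ips_set H (x - y).
Proof. by move=> Hx Hy; rewrite -scaleN1r; apply: subspaceD => //; exact: subspaceZ. Qed.

Lemma dotD x y z : ips_set H x -> ips_set H y -> ips_set H z ->
  ips_dot H (x + y) z = ips_dot H x z + ips_dot H y z.
Proof.
move=> Hx Hy Hz; case: ipH => lin _ _ _.
by have := lin 1 _ _ _ Hx Hy Hz; rewrite scale1r mul1r.
Qed.

Lemma dotZ a x z : ips_set H x -> ips_set H z ->
  ips_dot H (a *: x) z = a * ips_dot H x z.
Proof.
move=> Hx Hz; case: ipH => lin _ _ _.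
have d0 : ips_dot H 0 z = 0.
  have := lin 1 _ _ _ subH.1 subH.1 Hz; rewrite scale1r mul1r add0r => /eqP.
  by rewrite -subr_eq0 opprD addrA subrr sub0r oppr_eq0 => /eqP.
by have := lin a _ _ _ Hx subH.1 Hz; rewrite addr0 d0 addr0.
Qed.

Lemma Re_dotC x y : ips_set H x -> ips_set H y ->
  complex.Re (ips_dot H x y) = complex.Re (ips_dot H y x).
Proof. by move=> Hx Hy; case: ipH => _ sym _ _; rewrite (sym _ _ Hy Hx) Re_conjc. Qed.

Lemma hnorm_ge0 x : 0 <= hn x. Proof. exact: sqrtr_ge0. Qed.

Lemma sqr_hnorm x : ips_set H x -> hn x ^+ 2 = complex.Re (ips_dot H x x).
Proof.
by move=> Hx; rewrite sqr_sqrtr//; case: ipH => _ _ pos _; exact: Re_le (pos _ Hx).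
Qed.

Lemma sqr_hnormD x y : ips_set H x -> ips_set H y ->
  hn (x + y) ^+ 2 = hn x ^+ 2 + hn y ^+ 2 + 2 * complex.Re (ips_dot H x y).
Proof.
move=> Hx Hy; have Hxy := subspaceD Hx Hy.
rewrite !sqr_hnorm// dotD// ReD (Re_dotC Hx Hxy) (Re_dotC Hy Hxy) !dotD// !ReD.
by rewrite (Re_dotC Hy Hx); ring.
Qed.

Lemma hnormZ a x : ips_set H x -> hn (a *: x) = complex.Re `|a| * hn x.
Proof.
move=> Hx; have Hax := subspaceZ a Hx.
apply/eqP; rewrite -(eqrXn2 (n := 2))//; last 2 first.
- exact: hnorm_ge0.
- by rewrite mulr_ge0 ?hnorm_ge0// Re_normc_ge0.
rewrite exprMn !sqr_hnorm// dotZ//; case: ipH => _ sym _ _.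
rewrite (sym (a *: x) x)// dotZ// rmorphM/= mulrA mulc_conj Re_real_mul.
by rewrite Re_conjc.
Qed.

Lemma hnorm0_eq0 x : ips_set H x -> hn x = 0 -> x = 0.
Proof.
move=> Hx n0; case: ipH => _ _ pos def; apply: def => //.
have := sqr_hnorm Hx; rewrite n0 expr0n /= => e.
have := pos _ Hx; rewrite lecE => /andP[/eqP im _].
by apply/eqP; rewrite eq_complex -e im !eqxx.
Qed.

(** Yields the orthogonality of real and imaginary parts ([sqr_hnorm_recomp]) and
    a quadratic form of the triangle inequality ([sqr_hnormD_le]). *)
Lemma hnorm_parallelogram x y : ips_set H x -> ips_set H y ->
  hn (x + y) ^+ 2 + hn (x - y) ^+ 2 = 2 * (hn x ^+ 2 + hn y ^+ 2).
Proof.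
move=> Hx Hy; have HNy := subspaceZ (-1) Hy.
rewrite -[- y]scaleN1r !sqr_hnormD// hnormZ// normrN1 /= mul1r.
rewrite (Re_dotC Hx HNy) dotZ// mulN1r (Re_dotC Hx Hy).
by case: (ips_dot H y x) => ? ? /=; ring.
Qed.

Lemma sqr_hnormD_le x y : ips_set H x -> ips_set H y ->
  hn (x + y) ^+ 2 <= 2 * (hn x ^+ 2 + hn y ^+ 2).
Proof. by move=> Hx Hy; rewrite -hnorm_parallelogram// lerDl sqr_ge0. Qed.

End HilbertNorm.

Section RealParts.
Context (R : realType) (B : completeNormedModType R[i]).
Context (sigma : bounded_real_structure B).
Local Notation BR := (real_part sigma).
Local Notation Re_ := (re_part sigma).
Local Notation Im_ := (im_part sigma).
Implicit Types (x y : BR) (z : B).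

Lemma mulii : 'i%C * 'i%C = -1 :> R[i].
Proof. by apply/eqP; rewrite eq_complex /=; apply/andP; split; apply/eqP; ring. Qed.

Lemma conji : conjc 'i%C = - 'i%C :> R[i].
Proof. by apply/eqP; rewrite eq_complex /= oppr0 !eqxx. Qed.

Lemma i_neq0 : 'i%C != 0 :> R[i].
Proof. by rewrite eq_complex /= oner_eq0 andbF. Qed.

Lemma scale_half_double z : 2^-1 *: (z + z) = z.
Proof.
rewrite scalerDr -scalerDl (_ : _ + _ = 1) ?scale1r//.
by rewrite -[2^-1]mul1r -splitr.
Qed.

Lemma rval_re_part z : rval (Re_ z) = 2^-1 *: (z + sigma z).
Proof. by []. Qed.

Lemma rval_im_part z : rval (Im_ z) = (2 * 'i%C)^-1 *: (z - sigma z).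
Proof. by []. Qed.

Lemma re_im_decomp z : z = rval (Re_ z) + 'i%C *: rval (Im_ z).
Proof.
rewrite rval_re_part rval_im_part scalerA invfM mulrCA divff ?i_neq0//.
rewrite mulr1 -scalerDr.
by rewrite addrACA subrr addr0 scale_half_double.
Qed.

Lemma sigma_recomp x y :
  sigma (rval x + 'i%C *: rval y) = rval x - 'i%C *: rval y.
Proof. by rewrite linearD /= sigmaZ conji !rvalE scaleNr. Qed.

Lemma re_part_recomp x y : Re_ (rval x + 'i%C *: rval y) = x.
Proof.
apply: rval_inj; rewrite rval_re_part sigma_recomp addrACA subrr addr0.
exact: scale_half_double.
Qed.

Lemma im_part_recomp x y : Im_ (rval x + 'i%C *: rval y) = y.
Proof.
apply: rval_inj; rewrite rval_im_part sigma_recomp opprD opprK addrACA subrr add0r.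
rewrite invfM mulrC -scalerA scale_half_double scalerA mulVf ?i_neq0//.
exact: scale1r.
Qed.

(** Uniqueness of the decomposition [z = x + i y] turns the computation of [Re]
    and [Im] into the verification of an identity in [B]. *)
Lemma re_im_partP z x y :
  z = rval x + 'i%C *: rval y -> Re_ z = x /\ Im_ z = y.
Proof. by move=> ->; rewrite re_part_recomp im_part_recomp. Qed.

Lemma re_im_partD z z' :
  Re_ (z + z') = Re_ z + Re_ z' /\ Im_ (z + z') = Im_ z + Im_ z'.
Proof.
apply: re_im_partP.
rewrite -[rval (Re_ z + _)]/(rval (Re_ z) + rval (Re_ z')).
rewrite -[rval (Im_ z + _)]/(rval (Im_ z) + rval (Im_ z')).
by rewrite scalerDr addrACA -!re_im_decomp.
Qed.

Lemma cscale_recomp (a : R[i]) (u v : B) :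
  a *: (u + 'i%C *: v) =
  ((complex.Re a)%:C *: u - (complex.Im a)%:C *: v) +
  'i%C *: ((complex.Re a)%:C *: v + (complex.Im a)%:C *: u).
Proof.
case: a => p q /=.
have -> : (p +i* q)%C = p%:C + 'i%C * q%:C :> R[i].
  by apply/eqP; rewrite eq_complex /=; apply/andP; split; apply/eqP; ring.
rewrite scalerDr !scalerDl !scalerDr -!addrA; congr (_ + _).
rewrite !scalerA [LHS]addrCA [RHS]addrCA; congr (_ + _); first by rewrite mulrC.
rewrite addrC -scaleNr; congr (_ *: _ + _).
by rewrite mulrAC mulii mulN1r.
Qed.

Lemma re_im_partZ (a : R[i]) z :
  Re_ (a *: z) = complex.Re a *: Re_ z - complex.Im a *: Im_ z /\
  Im_ (a *: z) = complex.Re a *: Im_ z + complex.Im a *: Re_ z.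
Proof.
apply: re_im_partP; rewrite {1}(re_im_decomp z).
exact: cscale_recomp.
Qed.

End RealParts.

Lemma countable_image T T' (f : T -> T') (A : set T) :
  countable A -> countable (f @` A).
Proof. exact: card_le_trans (card_image_le _ _). Qed.

Lemma normci (R : realType) : `|'i%C : R[i]| = 1.
Proof. by rewrite normc_def /= expr0n expr1n add0r sqrtr1. Qed.

Lemma dense_image (S S' : topologicalType) (f : S -> S') (D : set S) :
  continuous f -> (forall y, exists x, f x = y) -> dense D -> dense (f @` D).
Proof.
move=> /continuousP cf surj dD U [y Uy] oU.
have [x fx] := surj y.
have [|x' [Ux' Dx']] := dD (f @^-1` U) _ (cf _ oU); first by exists x; rewrite /= fx.
by exists (f x'); split => //; exists x'.
Qed.

Section RealPartTopology.
Context (R : realType) (B : completeNormedModType R[i]).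
Context (sigma : bounded_real_structure B).
Local Notation BR := (real_part sigma).
Local Notation Re_ := (re_part sigma).
Local Notation Im_ := (im_part sigma).
Implicit Types (x y : BR) (z : B).

Lemma norm_re_im_le : exists2 C : R, 0 < C &
  forall z, `|Re_ z|%:C <= C%:C * `|z| /\ `|Im_ z|%:C <= C%:C * `|z|.
Proof.
have [C sC] := brs_bounded sigma.
have C1 : 0 < 1 + `|C| by rewrite ltr_pwDl.
exists (1 + `|C|) => // z.
have normi : `|'i%C| = 1 :> R[i] by exact: normci.
have key (a : R[i]) (w : B) : `|a| <= 1 -> `|w| <= (1 + `|C|)%:C * `|z| ->
    `|a *: w| <= (1 + `|C|)%:C * `|z|.
  by move=> a1 wz; rewrite normrZ (le_trans _ wz)// ler_piMl.
have half : `|2^-1| <= 1 :> R[i].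
  by rewrite normfV ger0_norm// invf_le1 ?ltr0n// ler1n.
have sz : `|z| + `|sigma z| <= (1 + `|C|)%:C * `|z|.
  rewrite rmorphD /= mulrDl mul1r lerD2l (le_trans (sC z))//.
  by rewrite ler_wpM2r// lecR ler_norm.
split; rewrite -rval_norm.
  by rewrite rval_re_part key// (le_trans (ler_normD _ _)).
rewrite rval_im_part key//.
  by rewrite invfM normrM [X in _ * X]normfV normi invr1 mulr1.
by rewrite (le_trans (ler_normB _ _)).
Qed.

Lemma norm_recomp_le x y :
  `|rval x + 'i%C *: rval y| <= (`|x| + `|y|)%:C.
Proof.
rewrite (le_trans (ler_normD _ _))// normrZ normci mul1r !rval_norm.
by rewrite rmorphD.
Qed.

Lemma real_part_lipschitz_continuous (f : B -> BR) (C : R) : 0 < C ->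
  (forall z z', f (z - z') = f z - f z') ->
  (forall z, `|f z|%:C <= C%:C * `|z|) -> continuous f.
Proof.
move=> C0 fB fC z; apply/cvgrPdist_lt => e e0.
near=> w; rewrite -fB -ltcR (le_lt_trans (fC _))//.
rewrite mulrC -ltr_pdivlMr ?ltcR//.
near: w; apply/nbhs_normP; exists (e%:C / C%:C) => //=.
by rewrite divr_gt0// ltcR.
Unshelve. all: by end_near. Qed.

Lemma re_im_partB z z' :
  Re_ (z - z') = Re_ z - Re_ z' /\ Im_ (z - z') = Im_ z - Im_ z'.
Proof.
have [<- <-] : Re_ (z - z' + z') = Re_ z /\ Im_ (z - z' + z') = Im_ z.
  by rewrite subrK.
by have [-> ->] := re_im_partD sigma (z - z') z'; rewrite !addrK.
Qed.

Lemma continuous_re_part : continuous Re_.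
Proof.
have [C C0 bnd] := norm_re_im_le.
apply: (@real_part_lipschitz_continuous _ C C0) => [z z'|z].
  exact: (re_im_partB z z').1.
exact: (bnd z).1.
Qed.

Lemma continuous_im_part : continuous Im_.
Proof.
have [C C0 bnd] := norm_re_im_le.
apply: (@real_part_lipschitz_continuous _ C C0) => [z z'|z].
  exact: (re_im_partB z z').2.
exact: (bnd z).2.
Qed.

Lemma re_part_surj x : exists z, Re_ z = x.
Proof. by exists (rval x + 'i%C *: rval (0 : BR)); rewrite re_part_recomp. Qed.

Lemma dense_recomp (D : set BR) : dense D ->
  dense [set rval p.1 + 'i%C *: rval p.2 | p in D `*` D].
Proof.
move=> dD U [z Uz] oU.
have /nbhs_ballP[e /= e0 eU] : nbhs z U by exact: open_nbhs_nbhs.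
have eE : (complex.Re e)%:C = e by rewrite RRe_real// gtr0_real.
have re0 : 0 < complex.Re e / 2 by rewrite divr_gt0// -ltcR eE.
have approx (x : BR) : exists2 y, D y & `|x - y| < complex.Re e / 2.
  have [|y [xy Dy]] := dD (ball x (complex.Re e / 2)) _ (ball_open _ _).
    by exists x; exact: ballxx.
  by exists y => //; move: xy; rewrite -ball_normE.
have [x Dx xz] := approx (Re_ z); have [y Dy yz] := approx (Im_ z).
exists (rval x + 'i%C *: rval y); split; last by exists (x, y).
apply: eU; rewrite -ball_normE /ball_/= {1}(re_im_decomp sigma z).
rewrite opprD addrACA -scalerBr.
rewrite -[rval (Re_ z) - rval x]/(rval (Re_ z - x)).
rewrite -[rval (Im_ z) - rval y]/(rval (Im_ z - y)).
rewrite (le_lt_trans (norm_recomp_le _ _))// -eE ltcR.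
by rewrite (splitr (complex.Re e)) ltrD.
Qed.

Lemma separable_real_part : separable B <-> separable BR.
Proof.
split=> -[D cD dD].
  exists (Re_ @` D); first exact: countable_image.
  by apply: dense_image dD; [exact: continuous_re_part|exact: re_part_surj].
eexists; last exact: dense_recomp dD.
by apply: countable_image; exact: countableX.
Qed.

End RealPartTopology.

Section RealSubspace.
Context (R : realType) (B : completeNormedModType R[i]).
Context (H : inner_product_subspace B).
Context (hH : is_hilbert_subspace (@complex.Re R) (@conjc R) H).
Context (sigma : bounded_real_structure B).
Context (hsigma : isometric_real_structure_on sigma H).
Local Notation BR := (real_part sigma).
Local Notation HR := (real_subspace sigma H).
Local Notation Re_ := (re_part sigma).
Local Notation Im_ := (im_part sigma).
Local Notation hn := (hnorm (@complex.Re R) H).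
Local Notation hnR := (hnorm id HR).
Implicit Types (x y : BR) (z : B).

Let subH : is_linear_subspace H. Proof. by case: hH. Qed.
Let ipH : is_inner_product (@conjc R) H. Proof. by case: hH. Qed.

Lemma hnorm_realE x : hnR x = hn (rval x). Proof. by []. Qed.

Lemma mem_re_im z : ips_set H z -> ips_set HR (Re_ z) /\ ips_set HR (Im_ z).
Proof.
move=> Hz; have [Hsz _] := hsigma Hz.
split; rewrite /= ?rval_re_part ?rval_im_part; apply: subspaceZ => //.
  exact: subspaceD.
exact: subspaceB.
Qed.

Lemma mem_recomp x y : ips_set HR x -> ips_set HR y ->
  ips_set H (rval x + 'i%C *: rval y).
Proof. by move=> Hx Hy; apply: subspaceD => //; exact: subspaceZ. Qed.

(** The isometry [sigma] exchanges [x + i y] and [x - i y], so both terms on the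
    left of the parallelogram identity are equal. *)
Lemma sqr_hnorm_recomp x y : ips_set HR x -> ips_set HR y ->
  hn (rval x + 'i%C *: rval y) ^+ 2 = hnR x ^+ 2 + hnR y ^+ 2.
Proof.
move=> Hx Hy; have Hiy := subspaceZ subH 'i%C Hy.
have [_ iso] := hsigma (mem_recomp Hx Hy).
have := hnorm_parallelogram subH ipH Hx Hiy.
rewrite -iso sigma_recomp (hnormZ subH ipH _ Hy) normci /= mul1r !hnorm_realE.
lra.
Qed.

Lemma sqr_hnorm_re_im z : ips_set H z ->
  hn z ^+ 2 = hnR (Re_ z) ^+ 2 + hnR (Im_ z) ^+ 2.
Proof.
move=> Hz; rewrite {1}(re_im_decomp sigma z).
by have [? ?] := mem_re_im Hz; rewrite sqr_hnorm_recomp.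
Qed.

Lemma hnorm_re_le z : ips_set H z -> hnR (Re_ z) <= hn z.
Proof.
move=> Hz; rewrite -(ler_pXn2r (n := 2))// ?nnegrE ?hnorm_ge0//.
by rewrite [leRHS]sqr_hnorm_re_im// lerDl sqr_ge0.
Qed.

Lemma hnorm_im_le z : ips_set H z -> hnR (Im_ z) <= hn z.
Proof.
move=> Hz; rewrite -(ler_pXn2r (n := 2))// ?nnegrE ?hnorm_ge0//.
by rewrite [leRHS]sqr_hnorm_re_im// lerDr sqr_ge0.
Qed.

Lemma real_inner_product : is_inner_product id HR.
Proof.
case: ipH => lin sym pos def; split.
- move=> a x y w Hx Hy Hw.
  rewrite -[LHS]/(complex.Re (ips_dot H (a%:C *: rval x + rval y) (rval w))).
  by rewrite lin// ReD Re_real_mul.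
- by move=> x y Hx Hy; rewrite /= (sym _ _ Hx Hy) Re_conjc.
- by move=> x Hx; exact: Re_le (pos _ Hx).
- move=> x Hx x0; apply: rval_inj; apply: (hnorm0_eq0 ipH Hx).
  by rewrite /hnorm -[complex.Re _]/(ips_dot HR x x) x0 sqrtr0.
Qed.

(** A Cauchy sequence of real points has a limit [l] in [H], and
    [sigma l - l = (u n - l) - sigma (u n - l)] is arbitrarily small in [H]. *)
Lemma real_hcomplete : hcomplete id HR.
Proof.
move=> u Hu cu; case: hH => _ _ /(_ (fun n => rval (u n)) Hu cu)[l Hl ul].
have [Hsl _] := hsigma Hl.
suff sl : sigma l = l.
  by have /eqP sl' := sl; exists (RealPart sl').
apply/eqP; rewrite -subr_eq0; apply/eqP; apply: (hnorm0_eq0 ipH).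
  exact: subspaceB.
apply/eqP; rewrite eq_le hnorm_ge0 andbT; apply/ler_addgt0Pr => e e0; rewrite add0r.
have [N /(_ N (leqnn _)) lN] := ul (e / 2) (ltac:(by rewrite divr_gt0)).
have Hd := subspaceB subH (Hu N) Hl.
have [Hsd isd] := hsigma Hd.
have -> : sigma l - l = (rval (u N) - l) + (- 1) *: sigma (rval (u N) - l).
  by rewrite linearB /= rvalE scaleN1r opprB [RHS]addrC subrKA.
rewrite -(ler_pXn2r (n := 2))// ?nnegrE ?hnorm_ge0// ?(ltW e0)//.
apply: (le_trans (sqr_hnormD_le subH ipH Hd (subspaceZ subH _ Hsd))).
rewrite hnormZ// normrN1 /= mul1r isd.
have := hnorm_ge0 H (rval (u N) - l); nra.
Qed.

Lemma real_hilbert_subspace : is_hilbert_subspace id id HR.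
Proof.
split; [|exact: real_inner_product|exact: real_hcomplete].
split; first exact: subH.1.
move=> a x y Hx Hy.
exact: (subH.2 a%:C _ _ Hx Hy).
Qed.

Lemma hseparable_real : hseparable (@complex.Re R) H <-> hseparable id HR.
Proof.
split=> -[D [cD DH dD]].
  exists (Re_ @` D); split; first exact: countable_image.
    by move=> _ [z Dz <-]; exact: (mem_re_im (DH _ Dz)).1.
  move=> x Hx e e0; have [z Dz zx] := dD _ Hx _ e0.
  exists (Re_ z); first by exists z.
  have -> : x - Re_ z = Re_ (rval x - z).
    rewrite (re_im_partB sigma _ _).1; congr (_ - _).
    by rewrite -{1}(re_part_recomp x 0) scaler0 addr0.
  apply: le_lt_trans zx; apply: hnorm_re_le.
  by apply: subspaceB => //; exact: DH.
exists [set rval p.1 + 'i%C *: rval p.2 | p in D `*` D]; split.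
- by apply: countable_image; exact: countableX.
- by move=> _ [[x y] [/= Dx Dy] <-]; apply: mem_recomp; exact: DH.
- move=> z Hz e e0; have [Hr Hi] := mem_re_im Hz.
  have e2 : 0 < e / 2 by rewrite divr_gt0.
  have [x Dx xz] := dD _ Hr _ e2; have [y Dy yz] := dD _ Hi _ e2.
  exists (rval x + 'i%C *: rval y); first by exists (x, y).
  rewrite {1}(re_im_decomp sigma z) opprD addrACA -scalerBr.
  rewrite -[rval (Re_ z) - rval x]/(rval (Re_ z - x)).
  rewrite -[rval (Im_ z) - rval y]/(rval (Im_ z - y)).
  rewrite -(ltr_pXn2r (n := 2))// ?nnegrE ?hnorm_ge0// ?(ltW e0)//.
  rewrite sqr_hnorm_recomp; last 2 first.
  + by apply: (subspaceB subH Hr); exact: DH.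
  + by apply: (subspaceB subH Hi); exact: DH.
  have := hnorm_ge0 H (rval (Re_ z - x)); have := hnorm_ge0 H (rval (Im_ z - y)).
  move: xz yz; rewrite !hnorm_realE; nra.
Qed.

Lemma dense_real_subspace : dense (H : set B) <-> dense (HR : set BR).
Proof.
split=> dH.
  have : dense (Re_ @` (H : set B)).
    by apply: dense_image dH; [exact: continuous_re_part|exact: re_part_surj].
  move=> dRH U U0 oU; have [x [Ux [z Hz zx]]] := dRH U U0 oU.
  by exists x; split => //; rewrite -zx; exact: (mem_re_im Hz).1.
move=> U U0 oU; have [z [Uz [[x y] [/= Hx Hy] xyz]]] := dense_recomp dH U0 oU.
by exists z; split => //; rewrite -xyz; exact: mem_recomp.
Qed.

Lemma hnorm_stronger_real :
  (exists C : R, forall z, ips_set H z -> complex.Re `|z| <= C * hn z) <->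
  (exists C : R, forall x, ips_set HR x -> `|x| <= C * hnR x).
Proof.
split=> -[C hC].
  by exists C => x Hx; have := hC _ Hx.
exists (`|C| + `|C|) => z Hz; have [Hr Hi] := mem_re_im Hz.
rewrite -lecR RRe_real ?normr_real// {1}(re_im_decomp sigma z).
rewrite (le_trans (norm_recomp_le _ _))// lecR mulrDl.
have bnd x : ips_set HR x -> hnR x <= hn z -> `|x| <= `|C| * hn z.
  move=> Hx xz; apply: (le_trans (hC _ Hx)).
  apply: le_trans (ler_wpM2r (hnorm_ge0 _ _) (ler_norm C)) _.
  by rewrite ler_wpM2l.
by rewrite lerD// bnd// ?hnorm_re_le// hnorm_im_le.
Qed.

End RealSubspace.

(** * Dual norms *)

Section UnitBallSup.
Context (R : realType).

Lemma mul_sup_le (S : set R) (a M : R) : 0 <= a -> S !=set0 ->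
  (forall s, S s -> a * s <= M) -> a * sup S <= M.
Proof.
rewrite le_eqVlt => /predU1P[<-|a0] S0 SM.
  by have [s /SM] := S0; rewrite !mul0r.
rewrite mulrC -ler_pdivlMr//; apply: ge_sup => // s Ss.
by rewrite ler_pdivlMr// mulrC SM.
Qed.

(** The operator norm inequality for a positively homogeneous [h], in a form
    that covers both scalar fields: [sc] is scaling by positive reals. *)
Lemma sup_unit_ball_le (V : Type) (A : set V) (n h : V -> R)
    (sc : R -> V -> V) (C : R) :
  (forall x, A x -> 0 <= n x) -> (forall x, A x -> h x <= C * n x) ->
  (forall c x, 0 < c -> A x ->
    [/\ A (sc c x), n (sc c x) = c * n x & h (sc c x) = c * h x]) ->
  forall x, A x -> h x <= sup [set h y | y in [set y | A y /\ n y <= 1]] * n x.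
Proof.
move=> n0 hC hom x Ax.
have [nx|nx] := eqVneq (n x) 0; first by have := hC _ Ax; rewrite nx !mulr0.
have {}nx : 0 < n x by rewrite lt_neqAle eq_sym nx n0.
have [Ac nc hc] := hom (n x)^-1 x (ltac:(by rewrite invr_gt0)) Ax.
rewrite -ler_pdivrMr// mulrC -hc; apply: ub_le_sup.
  exists `|C| => _ [y [Ay y1] <-]; apply: (le_trans (hC _ Ay)).
  apply: (@le_trans _ _ (`|C| * n y)); first by rewrite ler_wpM2r ?n0// ler_norm.
  by rewrite ler_piMr.
by exists (sc (n x)^-1 x) => //; split => //; rewrite nc mulVf// gt_eqF.
Qed.

End UnitBallSup.

Section DualNorm.
Context (R : realType) (B : completeNormedModType R[i]).
Context (H : inner_product_subspace B).
Context (hH : is_hilbert_subspace (@complex.Re R) (@conjc R) H).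
Context (sigma : bounded_real_structure B).
Context (hsigma : isometric_real_structure_on sigma H).
Local Notation BR := (real_part sigma).
Local Notation HR := (real_subspace sigma H).
Local Notation Re_ := (re_part sigma).
Local Notation Im_ := (im_part sigma).
Local Notation hn := (hnorm (@complex.Re R) H).
Local Notation hnR := (hnorm id HR).
Context (stronger :
  exists C : R, forall z, ips_set H z -> complex.Re `|z| <= C * hn z).

Let subH : is_linear_subspace H. Proof. by case: hH. Qed.
Let ipH : is_inner_product (@conjc R) H. Proof. by case: hH. Qed.

Lemma normc_realE (a : R) : `|a%:C| = `|a|%:C.
Proof. by rewrite normc_def /= expr0n addr0 sqrtr_sqr. Qed.

Lemma hnorm_realZ (a : R) (x : BR) : ips_set HR x -> hnR (a *: x) = `|a| * hnR x.
Proof.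
move=> Hx; rewrite !hnorm_realE -[rval _]/(a%:C *: rval x).
by rewrite (hnormZ subH ipH _ Hx) normc_realE.
Qed.

Lemma real_subspaceZ (a : R) (x : BR) : ips_set HR x -> ips_set HR (a *: x).
Proof. by move=> Hx; exact: (subspaceZ subH a%:C Hx). Qed.

Lemma dual_norm_bound (L : {scalar B}) : continuous L ->
  exists C : R, forall z, ips_set H z -> complex.Re `|L z| <= C * hn z.
Proof.
move=> /scalar_continuous_bounded[C C0 LC]; have [D HD] := stronger.
have CE : (complex.Re C)%:C = C by rewrite RRe_real// gtr0_real.
exists (complex.Re C * D) => z Hz.
have := Re_le (LC z); rewrite -CE Re_real_mul => /le_trans; apply.
by rewrite -mulrA ler_wpM2l ?HD// -lecR CE ltW.
Qed.

Lemma dual_norm_real_bound (f : {scalar BR}) : continuous f ->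
  exists C : R, forall x, ips_set HR x -> `|f x| <= C * hnR x.
Proof.
move=> /scalar_continuous_bounded[C C0 fC].
have [D HD] := (hnorm_stronger_real hH hsigma).1 stronger.
exists (C * D) => x Hx; rewrite (le_trans (fC x))// -mulrA ler_wpM2l ?HD//.
exact: ltW.
Qed.

Lemma le_dual_norm (L : {scalar B}) z : continuous L -> ips_set H z ->
  complex.Re `|L z| <= dual_norm (@complex.Re R) H L * hn z.
Proof.
move=> cL; have [C LC] := dual_norm_bound cL; move: z.
apply: (@sup_unit_ball_le _ _ _ hn (fun z => complex.Re `|L z|)
  (fun c z => c%:C *: z) C) => //.
  by move=> z _; exact: hnorm_ge0.
move=> c z c0 Hz; split; first exact: subspaceZ.
  by rewrite (hnormZ subH ipH _ Hz) normc_realE (gtr0_norm c0).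
by rewrite scalarZ normrM normc_realE (gtr0_norm c0) Re_real_mul.
Qed.

Lemma le_dual_norm_real (f : {scalar BR}) x : continuous f -> ips_set HR x ->
  `|f x| <= dual_norm id HR f * hnR x.
Proof.
move=> cf; have [C fC] := dual_norm_real_bound cf; move: x.
apply: (@sup_unit_ball_le _ _ _ hnR (fun x => `|f x|) (fun c x => c *: x) C) => //.
  by move=> z _; exact: hnorm_ge0.
move=> c x c0 Hx; split; first exact: real_subspaceZ.
  by rewrite hnorm_realZ// gtr0_norm.
by rewrite scalarZ normrM (gtr0_norm c0).
Qed.

Lemma unit_ball_real0 : ips_set HR 0 /\ hnR 0 <= 1.
Proof.
have H0 : ips_set HR 0 by exact: subH.1.
by split=> //; rewrite -(scale0r 0) hnorm_realZ// normr0 mul0r.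
Qed.

Lemma dual_norm_real_has_ubound (f : {scalar BR}) : continuous f ->
  has_ubound [set id `|f x| | x in [set x | ips_set HR x /\ hnR x <= 1]].
Proof.
move=> cf; have [C fC] := dual_norm_real_bound cf.
exists `|C| => _ [x [Hx x1] <-]; rewrite (le_trans (fC _ Hx))//.
apply: (@le_trans _ _ (`|C| * hnR x)); last by rewrite ler_piMr.
by rewrite ler_wpM2r ?hnorm_ge0// ler_norm.
Qed.

Lemma dual_norm_real_ge0 (f : {scalar BR}) : continuous f ->
  0 <= dual_norm id HR f.
Proof.
move=> cf; apply: ub_le_sup; first exact: dual_norm_real_has_ubound.
by exists 0; [exact: unit_ball_real0|rewrite raddf0 normr0].
Qed.

Lemma dual_norm_realZ (c : R) (f : {scalar BR}) : 0 <= c -> continuous f ->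
  dual_norm id HR (c \*o f) = c * dual_norm id HR f.
Proof.
move=> c0 cf; have ne := unit_ball_real0.
apply/eqP; rewrite eq_le; apply/andP; split.
  apply: ge_sup.
    by exists (id `|(c \*o f) (0 : BR)|), 0.
  move=> _ [x xb <-] /=; rewrite normrM ger0_norm// ler_wpM2l//.
  by apply: ub_le_sup; [exact: dual_norm_real_has_ubound|exists x].
apply: mul_sup_le => //; first by exists (id `|f (0 : BR)|), 0.
move=> _ [x xb <-] /=; apply: ub_le_sup; last first.
  by exists x => //=; rewrite normrM ger0_norm.
by apply: dual_norm_real_has_ubound; exact: continuous_scalarZ.
Qed.

Lemma Re_scalar_recomp (L : {scalar B}) (f g : BR -> R) z :
  (forall x, f x = complex.Re (L (rval x))) ->
  (forall y, g y = complex.Re (L ('i%C *: rval y))) ->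
  complex.Re (L z) = f (Re_ z) + g (Im_ z).
Proof. by move=> -> ->; rewrite {1}(re_im_decomp sigma z) raddfD /= ReD. Qed.

(** Multiplying [h] by a phase makes [L h] a nonnegative real, namely
    [f (Re h) + g (Im h)]; the Cauchy-Schwarz inequality in the plane then
    bounds the norm [N] of [L] by [r = sqrt (a^2 + b^2)], with [a] and [b] the
    norms of [f] and [g].  Conversely [h = a x + i b y], with [x] and [y] nearly
    norming for [f] and [g], has norm at most [r] and makes [Re (L h)] close to
    [a^2 + b^2 = r^2], so that [r^2 <= N r]. *)
Lemma sqr_dual_norm_split (L : {scalar B}) (f g : {scalar BR}) :
  continuous L -> continuous f -> continuous g ->
  (forall x, f x = complex.Re (L (rval x))) ->
  (forall y, g y = complex.Re (L ('i%C *: rval y))) ->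
  dual_norm (@complex.Re R) H L ^+ 2 =
  dual_norm id HR f ^+ 2 + dual_norm id HR g ^+ 2.
Proof.
move=> cL cf cg fE gE.
set N := dual_norm _ H L; set a := dual_norm id HR f; set b := dual_norm id HR g.
have a0 : 0 <= a by exact: dual_norm_real_ge0.
have b0 : 0 <= b by exact: dual_norm_real_ge0.
pose r := Num.sqrt (a ^+ 2 + b ^+ 2).
have r0 : 0 <= r by exact: sqrtr_ge0.
have rE : r ^+ 2 = a ^+ 2 + b ^+ 2 by rewrite sqr_sqrtr// addr_ge0// sqr_ge0.
have [H0 n0] := unit_ball_real0.
suff -> : N = r by [].
apply/eqP; rewrite eq_le; apply/andP; split.
  apply: ge_sup.
    by exists (complex.Re `|L 0|), 0.
  move=> _ [h [Hh h1] <-].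
  have [Lh0|Lh0] := eqVneq (L h) 0; first by rewrite Lh0 normr0.
  pose t := conjc (L h) / `|L h|.
  have nL : `|L h| != 0 by rewrite normr_eq0.
  have t1 : `|t| = 1.
    by rewrite normrM normfV normr_id norm_conjC mulfV.
  have tL : L (t *: h) = `|L h|.
    rewrite scalarZ /t mulrAC (mulrC _ (L h)) mulc_conj.
    by rewrite rmorphXn /= Re_normcK expr2 mulfK.
  have Hth := subspaceZ subH t Hh.
  have nth : hn (t *: h) = hn h by rewrite (hnormZ subH ipH _ Hh) t1 mul1r.
  rewrite -tL (Re_scalar_recomp _ fE gE).
  have [Hr Hi] := mem_re_im hH hsigma Hth.
  have fr := le_trans (ler_norm _) (le_dual_norm_real cf Hr).
  have gi := le_trans (ler_norm _) (le_dual_norm_real cg Hi).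
  have := sqr_hnorm_re_im hH hsigma Hth; rewrite nth.
  move: fr gi; rewrite -/a -/b.
  set u := hnR _; set v := hnR _ => fr gi uv.
  apply: (le_trans (lerD fr gi)).
  have u0 : 0 <= u by exact: hnorm_ge0.
  have v0 : 0 <= v by exact: hnorm_ge0.
  rewrite -(ler_pXn2r (n := 2))// ?nnegrE ?addr_ge0 ?mulr_ge0// rE.
  have : hn h ^+ 2 <= 1 by rewrite exprn_ile1// hnorm_ge0.
  rewrite uv => uv1.
  have : (a * u + b * v) ^+ 2 <= (a ^+ 2 + b ^+ 2) * (u ^+ 2 + v ^+ 2).
    by have := sqr_ge0 (a * v - b * u); lra.
  move=> /le_trans; apply; rewrite ler_piMr// addr_ge0// sqr_ge0//.
have N0 : 0 <= N.
  have [C LC] := dual_norm_bound cL; apply: ub_le_sup; last first.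
    by exists 0 => //; rewrite raddf0 normr0.
  exists `|C| => _ [z [Hz z1] <-]; rewrite (le_trans (LC _ Hz))//.
  apply: (@le_trans _ _ (`|C| * hn z)); last by rewrite ler_piMr.
  by rewrite ler_wpM2r ?hnorm_ge0// ler_norm.
have key (x y : BR) : ips_set HR x -> hnR x <= 1 -> ips_set HR y -> hnR y <= 1 ->
    a * `|f x| + b * `|g y| <= N * r.
  move=> Hx x1 Hy y1.
  (* The signs turn f x and g y into their absolute values. *)
  pose x' := (a * Num.sg (f x)) *: x; pose y' := (b * Num.sg (g y)) *: y.
  have Hx' := real_subspaceZ (a * Num.sg (f x)) Hx.
  have Hy' := real_subspaceZ (b * Num.sg (g y)) Hy.
  pose h := rval x' + 'i%C *: rval y'.
  have LhE : complex.Re (L h) = a * `|f x| + b * `|g y|.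
    rewrite (Re_scalar_recomp _ fE gE) re_part_recomp im_part_recomp.
    by rewrite !scalarZ -!mulrA -!normrEsg.
  rewrite -LhE (le_trans (ler_norm _))// (le_trans (normr_Re_le _))//.
  rewrite (le_trans (le_dual_norm cL (mem_recomp hH Hx' Hy')))// ler_wpM2l//.
  rewrite -(ler_pXn2r (n := 2))// ?nnegrE ?hnorm_ge0// rE.
  rewrite (sqr_hnorm_recomp hH hsigma Hx' Hy') !hnorm_realZ//.
  have sg_le (c : R) (u : BR) : 0 <= c -> hnR u <= 1 -> forall s : R,
      (`|c * Num.sg s| * hnR u) ^+ 2 <= c ^+ 2.
    move=> c0 u1 s; have u0 : 0 <= hnR u by exact: hnorm_ge0.
    rewrite ler_pXn2r// ?nnegrE ?mulr_ge0// normrM (ger0_norm c0) -mulrA ler_piMr//.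
    by rewrite mulr_ile1// normr_sg; case: (_ == _).
  by rewrite lerD// sg_le.
have keya (y : BR) : ips_set HR y -> hnR y <= 1 -> a * a <= N * r - b * `|g y|.
  move=> Hy y1; apply: mul_sup_le => //; first by exists (id `|f (0 : BR)|), 0.
  by move=> _ [x [Hx x1] <-]; rewrite lerBrDr key.
have keyb : b * b <= N * r - a * a.
  apply: mul_sup_le => //; first by exists (id `|g (0 : BR)|), 0.
  by move=> _ [y [Hy y1] <-]; rewrite lerBrDr addrC -lerBrDr keya.
have [->//|rn0] := eqVneq r 0.
have {}r0 : 0 < r by rewrite lt_neqAle eq_sym rn0.
by rewrite -(ler_pM2r r0) -expr2 rE !expr2 addrC -lerBrDr.
Qed.

End DualNorm.

(** * Complex functionals and their real traces *)

Section Functionals.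
Context (R : realType) (B : completeNormedModType R[i]).
Context (sigma : bounded_real_structure B).
Local Notation BR := (real_part sigma).
Local Notation Re_ := (re_part sigma).
Local Notation Im_ := (im_part sigma).

Definition re_restr (L : {scalar B}) (x : BR) : R := complex.Re (L (rval x)).
Definition im_restr (L : {scalar B}) (y : BR) : R :=
  complex.Re (L ('i%C *: rval y)).
(** The complex functional whose traces are [f] and [g]; its imaginary part is
    dictated by [F (i z) = i F z]. *)
Definition complexify (f g : BR -> R) (z : B) : R[i] :=
  (f (Re_ z) + g (Im_ z))%:C + 'i%C * (f (Im_ z) - g (Re_ z))%:C.

Fact re_restr_linear L : GRing.linear_for *%R (re_restr L).
Proof.
move=> a x y; rewrite /re_restr -[rval _]/(a%:C *: rval x + rval y).
by rewrite raddfD /= scalarZ ReD Re_real_mul.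
Qed.
HB.instance Definition _ L :=
  GRing.isLinear.Build R BR R *%R (re_restr L) (re_restr_linear L).

Fact im_restr_linear L : GRing.linear_for *%R (im_restr L).
Proof.
move=> a x y; rewrite /im_restr -[rval _]/(a%:C *: rval x + rval y).
rewrite scalerDr scalerA mulrC -scalerA.
by rewrite raddfD /= scalarZ ReD Re_real_mul.
Qed.
HB.instance Definition _ L :=
  GRing.isLinear.Build R BR R *%R (im_restr L) (im_restr_linear L).

Fact complexify_linear (f g : {scalar BR}) :
  GRing.linear_for *%R (complexify f g).
Proof.
move=> a z z'; rewrite /complexify.
have [-> ->] := re_im_partD sigma (a *: z) z'.
have [-> ->] := re_im_partZ sigma a z.
rewrite !raddfD !raddfN /= !scalarZ; case: a => p q /=.
by apply/eqP; rewrite eq_complex /=; apply/andP; split; apply/eqP; ring.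
Qed.
HB.instance Definition _ (f g : {scalar BR}) :=
  GRing.isLinear.Build R[i] B R[i] *%R (complexify f g) (complexify_linear f g).

Lemma continuous_Re_comp (L : {scalar B}) (f : {scalar BR}) (h : BR -> B) :
  continuous L -> (forall x, f x = complex.Re (L (h x))) ->
  (forall x, `|h x| = `|x|%:C) -> continuous f.
Proof.
move=> /scalar_continuous_bounded[C C0 LC] fE hE.
have CE : (complex.Re C)%:C = C by rewrite RRe_real// gtr0_real.
apply: (@scalar_bounded_continuous _ _ _ (complex.Re C)); first by rewrite -ltcR CE.
move=> x; rewrite fE (le_trans (normr_Re_le _))//.
by have := Re_le (LC (h x)); rewrite hE -CE Re_real_mul.
Qed.

Lemma continuous_re_restr (L : {scalar B}) : continuous L -> continuous (re_restr L).
Proof. by move=> cL; apply: (continuous_Re_comp cL) (@rval_norm _ _ _) => x. Qed.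

Lemma continuous_im_restr (L : {scalar B}) : continuous L -> continuous (im_restr L).
Proof.
move=> cL; apply: (@continuous_Re_comp L _ (fun x => 'i%C *: rval x) cL) => // x.
by rewrite normrZ normci mul1r rval_norm.
Qed.

Lemma continuous_complexify (f g : {scalar BR}) :
  continuous f -> continuous g -> continuous (complexify f g : {scalar B}).
Proof.
move=> /scalar_continuous_bounded[C C0 fC] /scalar_continuous_bounded[D D0 gD].
have [K K0 bnd] := norm_re_im_le sigma.
pose M := (C + D) * K + (C + D) * K.
apply: (@scalar_bounded_continuous _ _ _ M%:C).
  by rewrite ltcR /M addr_gt0// mulr_gt0// addr_gt0.
move=> z; have [zr zi] := bnd z.
have key (u v : BR) (s : R) : `|u|%:C <= K%:C * `|z| -> `|v|%:C <= K%:C * `|z| ->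
    `|s| <= C * `|u| + D * `|v| -> `|s%:C| <= ((C + D) * K)%:C * `|z|.
  move=> uz vz suv; rewrite normc_realE.
  apply: (@le_trans _ _ (C%:C * `|u|%:C + D%:C * `|v|%:C)).
    by rewrite -!rmorphM -rmorphD lecR.
  rewrite !rmorphM rmorphD /= -mulrA mulrDl lerD// ler_wpM2l// lecR ltW//.
have -> : M%:C * `|z| = ((C + D) * K)%:C * `|z| + ((C + D) * K)%:C * `|z|.
  by rewrite /M rmorphD /= mulrDl.
rewrite (le_trans (ler_normD _ _))// lerD//.
  apply: key zr zi _; rewrite (le_trans (ler_normD _ _))//.
  by rewrite lerD// ?fC// gD.
rewrite normrM normci mul1r.
apply: key zi zr _; rewrite (le_trans (ler_normB _ _))//.
by rewrite lerD// ?fC// gD.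
Qed.

Lemma Re_complexify (f g : BR -> R) z :
  complex.Re (complexify f g z) = f (Re_ z) + g (Im_ z).
Proof. by rewrite /complexify /=; ring. Qed.

Lemma complexify_re_restr (f g : {scalar BR}) x :
  f x = complex.Re (complexify f g (rval x)).
Proof.
have [|e1 e2] := @re_im_partP _ _ sigma (rval x) x 0.
  by rewrite -[rval (0 : BR)]/(0 : B) scaler0 addr0.
by rewrite Re_complexify e1 e2 raddf0 addr0.
Qed.

Lemma complexify_im_restr (f g : {scalar BR}) y :
  g y = complex.Re (complexify f g ('i%C *: rval y)).
Proof.
have [|e1 e2] := @re_im_partP _ _ sigma ('i%C *: rval y) 0 y.
  by rewrite -[rval (0 : BR)]/(0 : B) add0r.
by rewrite Re_complexify e1 e2 raddf0 add0r.
Qed.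

End Functionals.

Section ComplexIntegral.
Context (R : realType) d d' (T : measurableType d) (T' : measurableType d').
Context (P : probability T R).

Lemma measurable_cosR : measurable_fun setT (@cos R).
Proof. by apply: continuous_measurable_fun; exact: continuous_cos. Qed.

Lemma measurable_sinR : measurable_fun setT (@sin R).
Proof. by apply: continuous_measurable_fun; exact: continuous_sin. Qed.

Lemma complex_integral_distributed (X : T -> T') (nu : probability T' R)
    (h : T' -> R) : distributed_by P X nu -> measurable_fun setT h ->
  complex_integral nu (fun x => expi (h x)) =
  complex_integral P (fun w => expi (h (X w))).
Proof.
move=> [mX PX] mh.
pose X' : {mfun T >-> T'} := HB.pack X (isMeasurableFun.Build _ _ _ _ X mX).
have key (u : R -> R) : measurable_fun setT u -> (forall t, `|u t| <= 1) ->
    \int[nu]_x u (h x) = \int[P]_w u (h (X w)).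
  move=> mu u1; rewrite /Rintegral; congr fine.
  have mhu : measurable_fun setT (u \o h) by exact: measurableT_comp.
  rewrite -[RHS]/(\int[P]_w ((EFin \o (u \o h)) \o X') w)%E.
  rewrite -integral_distribution; first last.
  - apply: (@bounded_integrable _ _ _ P ((u \o h) \o X) 1) => [|w]; last exact: u1.
    exact: measurableT_comp.
  - exact/measurable_EFinP.
  by apply: eq_measure_integral => A mA _; exact: (esym (PX A mA)).
rewrite /complex_integral /expi /=.
rewrite (key _ measurable_cosR) ?(key _ measurable_sinR)//.
  by move=> t; exact: sin_max.
by move=> t; exact: cos_max.
Qed.

(** The addition formulas for [cos] and [sin] are exactly the multiplication of
    complex numbers. *)
Lemma independent_char (X Y : T -> T') (f g : T' -> R) :
  measurable_fun setT X -> measurable_fun setT Y -> independent P X Y ->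
  measurable_fun setT f -> measurable_fun setT g ->
  complex_integral P (fun w => expi (f (X w) + g (Y w))) =
  complex_integral P (fun w => expi (f (X w))) *
  complex_integral P (fun w => expi (g (Y w))).
Proof.
move=> mX mY iXY mf mg.
have mt (u v : R -> R) := fun (mu : measurable_fun setT u)
    (mv : measurable_fun setT v)
    (u1 : forall t, `|u t| <= 1) (v1 : forall t, `|v t| <= 1) =>
  @independent_Rintegral_prod _ _ _ _ _ P X Y (u \o f) (v \o g) 1 1 mX mY iXY
   (measurableT_comp mu mf) (measurableT_comp mv mg)
   (fun x => u1 _) (fun x => v1 _).
have int (u v : R -> R) : measurable_fun setT u -> measurable_fun setT v ->
    (forall t, `|u t| <= 1) -> (forall t, `|v t| <= 1) ->
    P.-integrable setT (EFin \o (fun w => u (f (X w)) * v (g (Y w)))).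
  move=> mu mv u1 v1; apply: (@bounded_integrable _ _ _ P _ 1).
    apply: measurable_funM.
      by apply: (measurableT_comp mu); apply: measurableT_comp mf mX.
    by apply: (measurableT_comp mv); apply: measurableT_comp mg mY.
  by move=> w; rewrite normrM mulr_ile1.
have mc := measurable_cosR; have ms := measurable_sinR.
have c1 (t : R) := cos_max t; have s1 (t : R) := sin_max t.
rewrite /complex_integral /expi /=.
under eq_Rintegral do rewrite cosD.
under [in X in _ +i* X]eq_Rintegral do rewrite sinD.
rewrite RintegralB ?RintegralD//; try exact: int.
rewrite (mt _ _ mc mc c1 c1) (mt _ _ ms ms s1 s1).
rewrite (mt _ _ ms mc s1 c1) (mt _ _ mc ms c1 s1) /=.
by apply/eqP; rewrite eq_complex /=; apply/andP; split; apply/eqP; ring.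
Qed.

End ComplexIntegral.

(** * Complex and real abstract Wiener spaces *)

Section SqrtTwo.
Context (R : realType).

Lemma sqr_sqrt2 : Num.sqrt 2 ^+ 2 = 2 :> R.
Proof. by rewrite sqr_sqrtr. Qed.

Lemma sqrt2_gt0 : 0 < Num.sqrt 2 :> R.
Proof. by rewrite sqrtr_gt0. Qed.

End SqrtTwo.

Lemma continuous_Re_scalar (R : realType) (B : completeNormedModType R[i])
    (L : {scalar B}) : continuous L ->
  continuous (fun z : B => complex.Re (L z)).
Proof.
move=> cL z; apply/cvgrPdist_lt => e e0.
have ec0 : 0 < e%:C :> R[i] by rewrite ltcR.
move/cvgrPdist_lt : (cL z) => /(_ _ ec0); apply: filterS => w.
rewrite -ltcR; apply: le_lt_trans.
have -> : complex.Re (L z) - complex.Re (L w) = complex.Re (L z - L w).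
  by case: (L z) (L w) => [? ?] [? ?].
by rewrite -[leRHS]RRe_real ?normr_real// lecR normr_Re_le.
Qed.

Section MainProof.
Context (R : realType) (B : completeNormedModType R[i]).
Context (H : inner_product_subspace B).
Context (hH : is_hilbert_subspace (@complex.Re R) (@conjc R) H).
Context (sigma : bounded_real_structure B).
Context (hsigma : isometric_real_structure_on sigma H).
Context (d : measure_display) (Omega : measurableType d) (P : probability Omega R).
Context (Z : {RV P >-> borel B}).
Local Notation BR := (real_part sigma).
Local Notation HR := (real_subspace sigma H).
Let X : Omega -> borel BR := fun w => Num.sqrt 2 *: re_part sigma (Z w).
Let Y : Omega -> borel BR := fun w => Num.sqrt 2 *: im_part sigma (Z w).

Let measurable_scaled_part (p : B -> BR) : continuous p ->
  measurable_fun setT ((fun w => Num.sqrt 2 *: p (Z w)) : Omega -> borel BR).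
Proof.
move=> cp; pose q (z : B) : BR := Num.sqrt 2 *: p z.
have cq : continuous q by move=> z; apply: cvgZr; exact: cp.
have mZ : measurable_fun setT Z by exact: measurable_funPT.
exact: (measurableT_comp (continuous_borel_measurable cq) mZ).
Qed.

Let mX : measurable_fun setT X.
Proof. by apply: measurable_scaled_part; exact: continuous_re_part. Qed.

Let mY : measurable_fun setT Y.
Proof. by apply: measurable_scaled_part; exact: continuous_im_part. Qed.

(** The characteristic function of [Z] at the functional with traces
    [sqrt 2 * f] and [sqrt 2 * g] is the joint characteristic function of
    [(X, Y)] at [(f, g)], and equals
    [exp (- |f|^2 / 2) * exp (- |g|^2 / 2)].  Taking [g = 0] or [f = 0] gives
    the marginals, which coincide. *)
Lemma real_wiener_of_complex :
  (exists nu : probability (borel B) R,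
     complex_abstract_wiener_space H nu /\ distributed_by P Z nu) ->
  exists nuR : probability (borel BR) R,
     [/\ real_abstract_wiener_space HR nuR, independent P X Y,
         distributed_by P X nuR & distributed_by P Y nuR].
Proof.
move=> [nu [[[_ sH] sB dH str char_nu] PZ]].
have dn2 (f : {scalar BR}) : continuous f ->
    dual_norm id HR (Num.sqrt 2 \*o f) ^+ 2 = 2 * dual_norm id HR f ^+ 2.
  move=> cf; rewrite (dual_norm_realZ hH hsigma str (ltW (sqrt2_gt0 R)) cf).
  by rewrite exprMn sqr_sqrt2.
have joint (f g : {scalar BR}) : continuous f -> continuous g ->
    complex_integral P (fun w => expi (f (X w) + g (Y w))) =
    (expR (- (1 / 2) * (dual_norm id HR f ^+ 2 + dual_norm id HR g ^+ 2)))%:C.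
  move=> cf cg.
  pose f2 : {scalar BR} := Num.sqrt 2 \*o f.
  pose g2 : {scalar BR} := Num.sqrt 2 \*o g.
  have cf2 : continuous f2 by exact: continuous_scalarZ.
  have cg2 : continuous g2 by exact: continuous_scalarZ.
  pose F : {scalar B} := complexify f2 g2.
  have cF : continuous F by exact: continuous_complexify.
  have := char_nu F cF.
  rewrite (sqr_dual_norm_split hH hsigma str cF cf2 cg2
    (complexify_re_restr f2 g2) (complexify_im_restr f2 g2)).
  rewrite !dn2// -mulrDr mulrA.
  rewrite (_ : - (1 / (2 * 2%:R)) * 2 = - (1 / 2)); last by field.
  move=> <-; rewrite /char_fun.
  rewrite (complex_integral_distributed (h := fun z : borel B => complex.Re (F z)) PZ).
    congr complex_integral; apply/funext => w; congr expi.
    by rewrite Re_complexify /= /X /Y !scalarZ.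
  by apply: continuous_borel_real_measurable; exact: continuous_Re_scalar.
have cz : continuous (\0 : {scalar BR}).
  by apply: (scalar_bounded_continuous ltr01) => x; rewrite normr0 mul1r.
have dn0 : dual_norm id HR (\0 : {scalar BR}) = 0.
  have := dual_norm_realZ hH hsigma str (lexx 0) cz; rewrite mul0r => <-.
  by congr dual_norm; apply/funext => x; rewrite /= mul0r.
have charX (f : {scalar BR}) : continuous f ->
    complex_integral P (fun w => expi (f (X w))) =
    (expR (- (1 / 2) * dual_norm id HR f ^+ 2))%:C.
  move=> cf; have := joint f \0 cf cz; rewrite dn0 expr0n addr0 => <-.
  by congr complex_integral; apply/funext => w; rewrite /= addr0.
have charY (g : {scalar BR}) : continuous g ->
    complex_integral P (fun w => expi (g (Y w))) =
    (expR (- (1 / 2) * dual_norm id HR g ^+ 2))%:C.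
  move=> cg; have := joint \0 g cz cg; rewrite dn0 expr0n add0r => <-.
  by congr complex_integral; apply/funext => w; rewrite /= add0r.
have sBR := (separable_real_part sigma).1 sB.
pose X' : {mfun Omega >-> borel BR} :=
  HB.pack X (isMeasurableFun.Build _ _ _ _ X mX).
exists (distribution P X'); split.
- split.
  + split; first exact: real_hilbert_subspace.
    exact: (hseparable_real hH hsigma).1.
  + exact: sBR.
  + exact: (dense_real_subspace hH hsigma).1.
  + exact: (hnorm_stronger_real hH hsigma).1.
  + move=> f cf; rewrite mulr1 -charX//.
    apply: (@complex_integral_distributed _ _ _ _ _ P X _ f).
      by split.
    exact: continuous_borel_real_measurable.
- apply: independent_of_char => // f g cf cg.
  by rewrite joint// charX// charY// mulrDr expRD rmorphM.
- by split.
- split=> // A mA; apply/esym.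
  apply: (eq_law_of_char sBR mX mY _ mA) => f cf.
  by rewrite charX// charY.
Qed.

(** With [f] and [g] the traces of [L], one has
    [Re (L Z) = f (c X) + g (c Y)] for [c = 1 / sqrt 2], and independence
    multiplies the characteristic functions of [X] and [Y]. *)
Lemma complex_wiener_of_real :
  (exists nuR : probability (borel BR) R,
     [/\ real_abstract_wiener_space HR nuR, independent P X Y,
         distributed_by P X nuR & distributed_by P Y nuR]) ->
  exists nu : probability (borel B) R,
     complex_abstract_wiener_space H nu /\ distributed_by P Z nu.
Proof.
move=> [nuR [[[_ sHR] sBR dHR strR char_nuR] iXY PX PY]].
have str := (hnorm_stronger_real hH hsigma).2 strR.
exists (distribution P Z); split; last first.
  by split=> //; exact: measurable_funPT.
split.
- by split => //; exact: (hseparable_real hH hsigma).2.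
- exact: (separable_real_part sigma).2.
- exact: (dense_real_subspace hH hsigma).2.
- exact: str.
move=> L cL.
pose c : R := (Num.sqrt 2)^-1.
have c0 : 0 <= c by rewrite invr_ge0 sqrtr_ge0.
have c2 : c ^+ 2 = 2^-1 by rewrite /c exprVn sqr_sqrt2.
pose f : {scalar BR} := re_restr L; pose g : {scalar BR} := im_restr L.
have cf : continuous f by exact: continuous_re_restr.
have cg : continuous g by exact: continuous_im_restr.
have charc (h : {scalar BR}) (V : Omega -> borel BR) : continuous h ->
    distributed_by P V nuR ->
    complex_integral P (fun w => expi ((c \*o h) (V w))) =
    (expR (- (1 / (2 * 2%:R)) * dual_norm id HR h ^+ 2))%:C.
  move=> ch PV; have cch : continuous (c \*o h) by exact: continuous_scalarZ.
  rewrite -(complex_integral_distributed PV); last first.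
    exact: continuous_borel_real_measurable.
  have := char_nuR _ cch; rewrite /char_fun => ->.
  rewrite (dual_norm_realZ hH hsigma str c0 ch) exprMn c2.
  by congr ((expR _)%:C); field.
rewrite /char_fun.
rewrite (sqr_dual_norm_split hH hsigma str cL cf cg (fun=> erefl) (fun=> erefl)).
rewrite mulrDr expRD rmorphM /= -(charc f X cf PX) -(charc g Y cg PY).
rewrite -independent_char//; last 2 first.
- by apply: continuous_borel_real_measurable; exact: continuous_scalarZ.
- by apply: continuous_borel_real_measurable; exact: continuous_scalarZ.
rewrite (complex_integral_distributed (P := P) (X := Z)
  (h := fun z : borel B => complex.Re (L z))).
- congr complex_integral; apply/funext => w; congr expi.
  rewrite (Re_scalar_recomp (sigma := sigma) _ (f := f) (g := g))//=.
  by rewrite /X /Y !scalarZ !mulrA mulVf ?gt_eqF ?sqrt2_gt0// !mul1r.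
- by split=> //; exact: measurable_funPT.
- by apply: continuous_borel_real_measurable; exact: continuous_Re_scalar.
Qed.

End MainProof.

Theorem theorem3p3 (R : realType) (B : completeNormedModType R[i])
    (H : inner_product_subspace B)
    (hH : is_hilbert_subspace (@complex.Re R) (@conjc R) H)
    (sigma : bounded_real_structure B)
    (hsigma : isometric_real_structure_on sigma H)
    (d : measure_display) (Omega : measurableType d) (P : probability Omega R)
    (Z : {RV P >-> borel B}) :
  let X : Omega -> borel (real_part sigma) :=
    fun w => Num.sqrt 2 *: re_part sigma (Z w) in
  let Y : Omega -> borel (real_part sigma) :=
    fun w => Num.sqrt 2 *: im_part sigma (Z w) in
  (exists nu : probability (borel B) R,
     complex_abstract_wiener_space H nu /\ distributed_by P Z nu)
  <->
  (exists nuR : probability (borel (real_part sigma)) R,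
     [/\ real_abstract_wiener_space (real_subspace sigma H) nuR,
         independent P X Y,
         distributed_by P X nuR
       & distributed_by P Y nuR]).
Proof.
move=> X Y; split; first exact: real_wiener_of_complex.
exact: complex_wiener_of_real.
Qed.
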